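(* Let $\mathcal C$ be a monotone class of finite graphs. The following are equivalent: (1) for every interpretation scheme $\mathsf I$ of graphs in graphs, the class $\mathsf I(\mathcal C)$ is random-free; (2) for every basic interpretation scheme $\mathsf I$ of graphs in graphs with exponent $1$, the class $\mathsf I(\mathcal C)$ is random-free; (3) the class $\mathcal C$ is nowhere dense.
   Context: Graphs are structures with one symmetric irreflexive binary relation. An interpretation scheme of graphs in graphs with exponent $k$ is given by first-order graph formulas $E(\mathbf x,\mathbf y)$, $\theta_0(\mathbf x)$, $\theta_1(\mathbf x,\mathbf y)$ ($\mathbf x,\mathbf y$ $k$-tuples of variables) such that $E$ defines an equivalence relation on $k$-tuples and $\theta_0,\theta_1$ are invariant under replacing tuples by $E$-equivalent ones; $\mathsf I(G)$ has as vertices the $E$-classes of $k$-tuples satisfying $\theta_0$, two classes being adjacent iff their representatives satisfy $\theta_1$ (the scheme yielding graphs). A basic interpretation scheme with exponent $1$ is given by a single formula $\theta(x_1,x_2)$: $\mathsf I(G)$ has vertex set $V(G)$ and $u\sim v$ iff $G\models\theta(u,v)$. $\mathsf I(\mathcal C)=\{\mathsf I(G):G\in\mathcal C\}$. A graphon is a symmetric measurable $W:[0,1]^2\to[0,1]$; a sequence $(G_n)$ is L-convergent to $W$ if $\hom(F,G_n)/|G_n|^{|F|}\to\int\prod_{ij\in E(F)}W(x_i,x_j)\,\mathrm dx$ for every finite graph $F$; $W$ is random-free if $\{0,1\}$-valued a.e. A class is random-free if every L-limit (graphon) of a sequence of graphs in the class is random-free. A monotone class (closed under subgraphs) $\mathcal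 C$ is nowhere dense if for every $p$ there is $N$ such that the graph obtained from $K_N$ by subdividing each edge $p$ times is not in $\mathcal C$. *)

(* Defs.v *)
From HB Require Import structures.
From mathcomp Require Import all_boot all_order all_algebra.
From mathcomp Require Import all_classical all_reals all_analysis.
Set Implicit Arguments. Unset Strict Implicit. Unset Printing Implicit Defensive.
Import Order.TTheory GRing.Theory Num.Theory.
Import numFieldNormedType.Exports.
Local Open Scope classical_set_scope.
Local Open Scope ring_scope.

Record graph := Graph {
  gV : finType;
  gE : rel gV;
  gE_sym : symmetric gE;
  gE_irr : irreflexive gE }.

Definition monotone_class (C : graph -> Prop) : Prop :=
  forall G H : graph, C G ->
    (exists f : gV H -> gV G, injective f /\
       forall u v, @gE H u v -> @gE G (f u) (f v)) -> C H.

Inductive fo :=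
| FAdj of nat & nat
| FEq of nat & nat
| FNot of fo
| FAnd of fo & fo
| FOr of fo & fo
| FEx of nat & fo
| FAll of nat & fo.

Definition upd (T : Type) (a : nat -> T) (i : nat) (v : T) : nat -> T :=
  fun j => if j == i then v else a j.

Fixpoint holds (V : finType) (e : rel V) (a : nat -> V) (f : fo) : bool :=
  match f with
  | FAdj i j => e (a i) (a j)
  | FEq i j => a i == a j
  | FNot g => ~~ holds e a g
  | FAnd g h => holds e a g && holds e a h
  | FOr g h => holds e a g || holds e a h
  | FEx i g => [exists v : V, holds e (upd a i v) g]
  | FAll i g => [forall v : V, holds e (upd a i v) g]
  end.

Fixpoint fv_in (P : nat -> bool) (f : fo) : bool :=
  match f with
  | FAdj i j | FEq i j => P i && P j
  | FNot g => fv_in P g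
  | FAnd g h | FOr g h => fv_in P g && fv_in P h
  | FEx i g | FAll i g => fv_in (fun j => (j == i) || P j) g
  end.

(* assignments: x = (x_0..x_{K-1}) to variables 0..K-1, y to K..2K-1
   (the default value is irrelevant since free variables are bounded) *)
Definition env1 (V : Type) K (t : K.+1.-tuple V) : nat -> V :=
  fun i => nth (tnth t ord0) t i.
Definition env2 (V : Type) K (t u : K.+1.-tuple V) : nat -> V :=
  fun i => nth (tnth t ord0) (t ++ u) i.

(* exponent = sk.+1 (a positive integer) *)
Record scheme := Scheme { sk : nat; sE : fo; s0 : fo; s1 : fo }.

Definition valid_scheme (S : scheme) : Prop :=
  let K := (sk S).+1 in
  [/\ fv_in (fun i => (i < 2 * K)%N) (sE S), fv_in (fun i => (i < K)%N) (s0 S),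
      fv_in (fun i => (i < 2 * K)%N) (s1 S) &
  forall G : graph,
    let E t u := holds (@gE G) (env2 t u) (sE S) in
    let T0 t := holds (@gE G) (env1 t) (s0 S) in
    let T1 t u := holds (@gE G) (env2 t u) (s1 S) in
    ((forall t : K.-tuple (gV G), E t t) /\
     (forall t u : K.-tuple (gV G), E t u -> E u t) /\
     (forall t u w : K.-tuple (gV G), E t u -> E u w -> E t w)) /\
    ((forall t t' : K.-tuple (gV G), E t t' -> T0 t = T0 t') /\
     (forall t t' u u' : K.-tuple (gV G), E t t' -> E u u' -> T1 t u = T1 t' u')) /\
    ((forall t u : K.-tuple (gV G), T0 t -> T0 u -> T1 t u = T1 u t) /\
     (forall t : K.-tuple (gV G), T0 t -> ~~ T1 t t))].

Section Interp.
Variables (S : scheme) (G : graph).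
Let K := (sk S).+1.
Let T := (K.-tuple (gV G)).
Definition iclass (t : T) : {set T} := [set u | holds (@gE G) (env2 t u) (sE S)].
Definition ivset : {set {set T}} :=
  [set iclass t | t in [set t : T | holds (@gE G) (env1 t) (s0 S)]].
Definition ivert : finType := {A : {set T} | A \in ivset}.
Definition iedge : rel ivert :=
  fun A B => [exists t in val A, exists u in val B, holds (@gE G) (env2 t u) (s1 S)].
Definition interp : {V : finType & rel V} := existT _ ivert iedge.
End Interp.

Definition env_pair (V : Type) (u v : V) : nat -> V := fun i => nth u [:: u; v] i.

Definition valid_basic (th : fo) : Prop :=
  fv_in (fun i => (i < 2)%N) th /\
  forall G : graph, forall u v : gV G,
    holds (@gE G) (env_pair u v) th = holds (@gE G) (env_pair v u) th /\
    ~~ holds (@gE G) (env_pair u u) th.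

Definition basic_interp (th : fo) (G : graph) : {V : finType & rel V} :=
  existT _ (gV G) (fun u v => holds (@gE G) (env_pair u v) th).

Section Graphons.
Variable R : realType.

Definition hom_count (F : graph) (V : finType) (e : rel V) : nat :=
  #|[set f : {ffun gV F -> V} | [forall u, forall v, @gE F u v ==> e (f u) (f v)]]|.

Definition hom_density (F : graph) (H : {V : finType & rel V}) : R :=
  (hom_count F (projT2 H))%:R / (#|projT1 H|%:R ^+ #|gV F|).

Fixpoint iint (n : nat) (f : (nat -> R) -> R) (x : nat -> R) : R :=
  match n with
  | 0 => f x
  | n'.+1 => Rintegral lebesgue_measure `[0%R, 1%R]
               (fun s => iint n' f (upd x n' s))
  end.

Definition unit_sq : set (R * R) := `[0%R, 1%R] `*` `[0%R, 1%R].

Definition graphon (W : R -> R -> R) : Prop :=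
  measurable_fun unit_sq (fun z : R * R => W z.1 z.2) /\
  forall x y, x \in `[0%R, 1%R] -> y \in `[0%R, 1%R] ->
    0 <= W x y <= 1 /\ W x y = W y x.

Definition graphon_density (F : graph) (W : R -> R -> R) : R :=
  iint #|gV F|
    (fun x => \prod_(p : gV F * gV F | (enum_rank p.1 < enum_rank p.2)%N && @gE F p.1 p.2)
                W (x (enum_rank p.1)) (x (enum_rank p.2)))
    (fun _ => 0).

Definition L_converges (Hs : nat -> {V : finType & rel V}) (W : R -> R -> R) : Prop :=
  forall F : graph,
    (fun n => hom_density F (Hs n)) @ \oo --> graphon_density F W.

Definition random_free_graphon (W : R -> R -> R) : Prop :=
  {ae (@lebesgue_measure R \x @lebesgue_measure R)%E,
     forall z : R * R, z \in unit_sq -> W z.1 z.2 = 0 \/ W z.1 z.2 = 1}.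

Definition random_free_image (C : graph -> Prop) (I : graph -> {V : finType & rel V}) : Prop :=
  forall (Gs : nat -> graph), (forall n, C (Gs n)) ->
  forall W, graphon W -> L_converges (fun n => I (Gs n)) W -> random_free_graphon W.
End Graphons.

Section Subdiv.
Variables (N p : nat).
Definition sdedge : finType := {e : 'I_N * 'I_N | (e.1 < e.2)%N}.
Definition sdV : finType := ('I_N + sdedge * 'I_p)%type.
Definition sd_dir (a b : sdV) : bool :=
  match a, b with
  | inl i, inl j => (p == 0)%N && (i < j)%N
  | inl i, inr (e, l) =>
      ((i == (val e).1) && (l == 0 :> nat)) || ((i == (val e).2) && (l == p.-1 :> nat))
  | inr (e, l), inr (e', m) => (e == e') && (m == (l.+1) :> nat)
  | inr _, inl _ => false
  end.
Definition sd_adj : rel sdV := fun a b => sd_dir a b || sd_dir b a.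
Lemma sd_adj_sym : symmetric sd_adj.
Proof. by move=> a b; rewrite /sd_adj orbC. Qed.
Lemma sd_adj_irr : irreflexive sd_adj.
Proof.
case=> [i|[e l]]; rewrite /sd_adj orbb /=.
  by rewrite ltnn andbF.
rewrite eqxx /=; apply/negbTE; by rewrite neq_ltn ltnSn.
Qed.
Definition subdiv_clique : graph := Graph sd_adj_sym sd_adj_irr.
End Subdiv.

Definition nowhere_dense (C : graph -> Prop) : Prop :=
  forall p : nat, exists N : nat, ~ C (subdiv_clique N p).

(* Main.v *)
(* Nowhere dense => random-free. If a shattered set of tuples exists in a graph of the class, then
   by uniform quasi-wideness one may delete boundedly many vertices S so that many of the tuples are
   pairwise far apart, and by pigeonhole they have the same local type over S. A locality argument in
   the style of Gaifman shows that a formula cannot distinguish, with a parameter b far from both,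
   two tuples of such a family; but b is close to boundedly many of them only, so b cannot cut out
   half of the family. Hence interpretations have bounded VC dimension. In the limit W, some bipartite
   pattern then has density 0, and this density is at least the density of a complete bipartite graph
   in f = W (1 - W); therefore f = 0 almost everywhere.

   Random-free => nowhere dense. Otherwise the class contains, for some p, the p-subdivisions of all
   graphs. Take the universal graph on the pairs (i, J) with i < d and J a subset of {0..d-1}, in which
   (i, J) and (i', J') with i < i' are adjacent iff i lies in J'; subdivide it and hang so many leaves
   on each vertex that almost all vertices are leaves. "The leaves x, y hang on vertices at distance
   at most p + 1" is a first-order formula, and since the events "i lies in J'" are independent fair
   coin flips, the interpreted graphs converge to the constant graphon 1/2. *)
Require Import Defs.
From mathcomp Require Import all_boot all_order all_algebra.
From mathcomp Require Import zify boolp.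
Set Implicit Arguments. Unset Strict Implicit. Unset Printing Implicit Defensive.

(** * Ramsey theory *)

(** In quasi-wideness the number of deleted vertices depends on the radius alone, so the number of
    local types over them is fixed before the size of the family is chosen. Edges to the deleted
    vertices can still be seen by formulas; the types record them. Shattering is an induced pattern,
    while homomorphism densities see only the presence of edges. Inclusion-exclusion writes the
    indicator of the pattern as a signed sum of products over edge sets, so its vanishing passes to
    the limit. Both W and 1 - W dominate W (1 - W), so the pattern dominates the complete bipartite
    product whatever its shape. Conversely, a basic interpretation keeps every vertex, subdivision
    vertices included; the leaves make these negligible. A leaf is found on a subdivided edge of a
    larger clique, so monotonicity supplies it. The order of first coordinates decides which of two
    sites carries the coin of the pair; pairs with equal first coordinates become rare as d
    grows. *)

Lemma card_subsets (T : finType) : #|{set T}| = 2 ^ #|T|.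
Proof. by rewrite -[LHS]cardsT -powersetT card_powerset cardsT. Qed.

Lemma ramsey (s t : nat) : exists N, forall (T : finType) (e : rel T) (A : {set T}),
  symmetric e -> N <= #|A| ->
  (exists2 B : {set T}, B \subset A & #|B| = s /\ {in B &, forall x y, x != y -> e x y}) \/
  (exists2 B : {set T}, B \subset A & #|B| = t /\ {in B &, forall x y, x != y -> ~~ e x y}).
Proof.
have empty (T : finType) (A : {set T}) (P : T -> T -> Prop) :
    exists2 B : {set T}, B \subset A & #|B| = 0 /\ {in B &, forall x y, x != y -> P x y}.
  by exists set0; [exact: sub0set | split; [exact: cards0 | move=> x y; rewrite inE]].
elim: s t => [|s IHs] t; first by exists 0 => T e A _ _; left; apply: empty.
elim: t => [|t [N2 R2]]; first by exists 0 => T e A _ _; right; apply: empty.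
have [N1 R1] := IHs t.+1.
exists (N1 + N2).+1 => T e A se leA.
have [x xA] : exists x, x \in A by apply/card_gt0P; lia.
set A1 := [set y in A :\ x | e x y]; set A2 := [set y in A :\ x | ~~ e x y].
have cA : #|A| = (#|A1| + #|A2|).+1.
  rewrite (cardsD1 x) xA add1n; congr S.
  rewrite -cardsUI [A1 :&: A2](_ : _ = set0) ?cards0 ?addn0; last first.
    by apply/setP=> y; rewrite !inE; case: (e x y); rewrite ?andbF.
  by congr #|pred_of_set _|; apply/setP=> y; rewrite !inE; case: (e x y); rewrite ?andbT ?andbF ?orbF.
have ext (P : rel T) (B A' : {set T}) k : symmetric P -> B \subset A' -> A' \subset A :\ x ->
    (forall y, y \in A' -> P x y) -> #|B| = k /\ {in B &, forall y z, y != z -> P y z} ->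
    x |: B \subset A /\ #|x |: B| = k.+1 /\ {in x |: B &, forall y z, y != z -> P y z}.
  move=> sP BA' A'A Px [cB PB]; have BA := fintype.subset_trans BA' A'A.
  split.
    by rewrite subUset sub1set xA; apply: (fintype.subset_trans BA); apply: subsetDl.
  split; first by rewrite cardsU1 cB; case: (boolP (x \in B)) => // /(fintype.subsetP BA); rewrite !inE eqxx.
  move=> y z; rewrite !inE => /orP[/eqP->|yB] /orP[/eqP->|zB] yz.
  - by rewrite eqxx in yz.
  - by apply: Px; apply: (fintype.subsetP BA').
  - by rewrite sP; apply: Px; apply: (fintype.subsetP BA').
  - exact: PB.
have sA1 : A1 \subset A :\ x by apply/fintype.subsetP=> y; rewrite inE => /andP[].
have sA2 : A2 \subset A :\ x by apply/fintype.subsetP=> y; rewrite inE => /andP[].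
have A1A : A1 \subset A by apply: fintype.subset_trans (subsetDl _ _); exact: sA1.
have A2A : A2 \subset A by apply: fintype.subset_trans (subsetDl _ _); exact: sA2.
have [le1|lt1] := leqP N1 #|A1|.
  have [[B BA HB]|[B BA HB]] := R1 T e A1 se le1.
    left; have [|H1 H2] := ext e B A1 s se BA sA1 _ HB.
      by move=> y; rewrite inE => /andP[].
    by exists (x |: B).
  by right; exists B => //; apply: (fintype.subset_trans BA).
have le2 : N2 <= #|A2| by lia.
have [[B BA HB]|[B BA HB]] := R2 T e A2 se le2.
  by left; exists B => //; apply: (fintype.subset_trans BA).
right; have [||H1 H2] := ext (fun y z => ~~ e y z) B A2 t _ BA sA2 _ HB.
- by move=> y z; rewrite se.
- by move=> y; rewrite inE => /andP[].
by exists (x |: B).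
Qed.

Lemma large_fiber (I T : finType) (J : {set I}) (f : I -> T) k m :
  #|f @: J| <= k -> k * m < #|J| -> exists v, m < #|[set l in J | f l == v]|.
Proof.
move=> le lt; apply: contrapT => no; move: lt; apply/negP; rewrite -leqNgt.
rewrite -sum1_card (partition_big_imset f) /=.
apply: (@leq_trans (\sum_(v in f @: J) m)); last by rewrite sum_nat_const leq_mul2r le orbT.
apply: leq_sum => v _; rewrite sum1_card leqNgt; apply/negP => lt; apply: no; exists v.
by apply: leq_trans lt _; apply: subset_leq_card; apply/fintype.subsetP=> l; rewrite !inE.
Qed.


(** Colours may overlap, and the clique size depends on the colour because nowhere density gives
    each path length its own bound. The last colour is peeled off: a set without edges of colour [D]
    is covered by the remaining ones. *)
Lemma ramsey_cover (N : nat -> nat) (D : nat) : exists M,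
  forall (T : finType) (e : nat -> rel T) (A : {set T}),
  (forall p, symmetric (e p)) -> M <= #|A| ->
  {in A &, forall x y, x != y -> exists2 p, p < D & e p x y} ->
  exists2 p, p < D & exists2 B : {set T}, B \subset A &
    #|B| = N p /\ {in B &, forall x y, x != y -> e p x y}.
Proof.
elim: D => [|D [M HM]].
  exists 2 => T e A _ /card_gt1P[x [y [xA yA xy]]] cov.
  by have [] := cov x y xA yA xy.
have [M' HM'] := ramsey (N D) M.
exists M' => T e A se leA cov.
have [[B BA HB]|[B BA [cB HB]]] := HM' T (e D) A (se D) leA; first by exists D => //; exists B.
have [||p pD [B' B'B HB']] := HM T e B se; first by rewrite cB.
  move=> x y xB yB xy.
  have [p + ep] := cov x y (fintype.subsetP BA x xB) (fintype.subsetP BA y yB) xy.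
  rewrite ltnS leq_eqVlt => /orP[/eqP E|]; last by exists p.
  by have := HB x y xB yB xy; rewrite -E ep.
by exists p; [exact: leqW | exists B' => //; exact: fintype.subset_trans BA].
Qed.

(** * Distances after deletion of vertices *)

Lemma rev_path_sym (T : Type) (e : rel T) x w :
  symmetric e -> path e (last x w) (rev (belast x w)) = path e x w.
Proof. by move=> es; rewrite rev_path; under eq_path do rewrite es. Qed.

Lemma last_rev_belast (T : Type) (x : T) w : last (last x w) (rev (belast x w)) = x.
Proof. by case: w => //= y w; rewrite rev_cons last_rcons. Qed.

Section Near.
Variables (V : finType) (e : rel V).
Hypothesis e_sym : symmetric e.
Implicit Types (S : {set V}) (u v w : V).

Definition avoid S : rel V := fun u v => [&& u \notin S, v \notin S & e u v].

(* Vertices of [S] are near nothing, not even themselves. *)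
Definition near S (r : nat) u v : Prop :=
  u \notin S /\ exists w : seq V, [/\ path (avoid S) u w, last u w = v & size w <= r].

Lemma avoid_sym S : symmetric (avoid S).
Proof. by move=> u v; rewrite /avoid e_sym; case: (u \notin S); case: (v \notin S). Qed.

Lemma near_sym S r u v : near S r u v -> near S r v u.
Proof.
move=> [uS [w [pw lw sw]]]; split.
  elim: w u uS pw lw {sw} => [|x w IH] u uS /=; first by move=> _ <-.
  by move=> /andP[/and3P[_ xS _] pw]; apply: IH.
exists (rev (belast u w)); split.
- by rewrite -lw rev_path_sym //; exact: avoid_sym.
- by rewrite -lw last_rev_belast.
- by rewrite size_rev size_belast.
Qed.

Lemma near_notin S r u v : near S r u v -> u \notin S /\ v \notin S.
Proof. by move=> H; split; [case: H | case: (near_sym H)]. Qed.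

Lemma near_trans S r r' u v w : near S r u v -> near S r' v w -> near S (r + r') u w.
Proof.
move=> [uS [p [pp lp sp]]] [vS [q [pq lq sq]]]; split=> //.
exists (p ++ q); split; first by rewrite cat_path pp lp.
- by rewrite last_cat lp.
- by rewrite size_cat leq_add.
Qed.

Lemma near_le S r r' u v : r <= r' -> near S r u v -> near S r' u v.
Proof. by move=> le [uS [w [pw lw sw]]]; split=> //; exists w; split=> //; apply: leq_trans le. Qed.

Lemma near_subset S S' r u v : S \subset S' -> near S' r u v -> near S r u v.
Proof.
move=> /fintype.subsetP SS [uS [w [pw lw sw]]]; split; first by apply: contra uS; exact: SS.
exists w; split=> //; apply: sub_path pw => x y /and3P[xS yS exy].
by apply/and3P; split=> //; [apply: contra xS | apply: contra yS]; exact: SS.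
Qed.

Lemma near_refl S r u : u \notin S -> near S r u u.
Proof. by move=> uS; split=> //; exists [::]. Qed.

Lemma near_edge S u v : u \notin S -> v \notin S -> e u v -> near S 1 u v.
Proof. by move=> uS vS euv; split=> //; exists [:: v]; split=> //=; rewrite /avoid uS vS euv. Qed.

Definition scattered S r (B : {set V}) :=
  {in B &, forall u v, u != v -> ~ near S r u v}.

End Near.

(** Monotone classes ask only for a copy that need not be induced, so chords between the paths are
    harmless. *)
Lemma subdivision_embeds (G : graph) (t p : nat) (b : 'I_t -> gV G)
    (q : 'I_t -> 'I_t -> seq (gV G)) :
  injective b ->
  (forall i j : 'I_t, i < j -> [/\ path (@gE G) (b i) (rcons (q i j) (b j)), size (q i j) = p,
     uniq (q i j) & forall k, b k \notin q i j]) ->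
  (forall (i j i' j' : 'I_t) x, i < j -> i' < j' -> x \in q i j -> x \in q i' j' -> (i, j) = (i', j')) ->
  exists f : sdV t p -> gV G, injective f /\ forall u v, sd_adj u v -> gE (f u) (f v).
Proof.
move=> bI Hq Hd.
pose f (a : sdV t p) := match a with
  | inl i => b i
  | inr (e, l) => nth (b (val e).1) (q (val e).1 (val e).2) l end.
have Hl (e : sdedge t) (l : 'I_p) : f (inr (e, l)) \in q (val e).1 (val e).2.
  by have [_ s _ _] := Hq _ _ (valP e); apply: mem_nth; rewrite s.
exists f; split.
  move=> [i|[e l]] [j|[e' l']].
  - by move/bI ->.
  - have := Hl e' l'; have [_ _ _ /(_ i) nb] := Hq _ _ (valP e').
    by move=> H eq; move: H; rewrite -eq /= (negbTE nb).
  - have := Hl e l; have [_ _ _ /(_ j) nb] := Hq _ _ (valP e).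
    by move=> H eq; move: H; rewrite eq /= (negbTE nb).
  - move=> eq; have := Hl e l; rewrite eq => /(Hd _ _ _ _ _ (valP e') (valP e) (Hl e' l')) ee.
    have {ee} ee : e = e'.
      by apply: val_inj; rewrite [val e]surjective_pairing [val e']surjective_pairing.
    subst e'; have [_ s u _] := Hq _ _ (valP e).
    congr (inr (_, _)); apply: val_inj => /=; move: eq; rewrite /f => /eqP.
    by rewrite nth_uniq ?s // => /eqP.
have dir u v : sd_dir u v -> gE (f u) (f v); last first.
  by move=> u v /orP[/dir//|/dir]; rewrite gE_sym.
case: u v => [i|[e l]] [j|[e' l']] //=.
- move=> /andP[/eqP p0 ij]; have [+ s _ _] := Hq _ _ ij.
  by rewrite p0 in s; case: (q i j) s => //= _; rewrite andbT.
- have [/(pathP (b (val e').1)) pq s _ _] := Hq _ _ (valP e').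
  rewrite size_rcons s in pq.
  case/orP=> /andP[/eqP -> /eqP ->].
    have p0 : 0 < p by case: (p) l' => [[]|].
    by have := pq 0 isT; rewrite /= nth_rcons s p0.
  have p0 : 0 < p by case: (p) l' => [[]|].
  have := pq p (leqnn _); rewrite gE_sym -rcons_cons !nth_rcons /= s ltnS leqnn.
  by rewrite ltnn eqxx; case: (p) p0.
- move=> /andP[/eqP ee /eqP eq]; subst e'; rewrite eq.
  have [/(pathP (b (val e).1)) pq s _ _] := Hq _ _ (valP e).
  rewrite size_rcons s in pq.
  have := pq l.+1; rewrite -rcons_cons !nth_rcons /= s => H.
  have lt := ltn_ord l'; rewrite eq in lt.
  by have := H (ltnW lt); rewrite ltnS ltnW // lt.
Qed.

(** * Uniform quasi-wideness *)

(* The list [pi x] omits the starting vertex [c] of the path, so the paths of a star share [c] only. *)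
Definition star (V : finType) (e : rel V) (c : V) r (X : {set V}) (pi : V -> seq V) :=
  {in X, forall x, [/\ path e c (pi x), last c (pi x) = x & size (pi x) <= r]} /\
  {in X &, forall x y, x != y -> ~~ has (mem (pi x)) (pi y)}.

Lemma star_subset (V : finType) (e : rel V) c r (X Y : {set V}) pi :
  Y \subset X -> star e c r X pi -> star e c r Y pi.
Proof.
move=> /fintype.subsetP YX [H1 H2]; split=> [x /YX/H1 //|x y /YX xX /YX yX]; exact: H2.
Qed.

(* Ramsey: either many of the paths are disjoint, or many of them meet one fixed path, hence many
   pass through one of its vertices, which is closer to their ends than [b]. *)
Lemma star_exists r K : exists N, forall (V : finType) (e : rel V) (b : V) (X : {set V}),
  N <= #|X| ->
  {in X, forall x, exists w, [/\ path e b w, last b w = x & size w <= r]} ->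
  exists (c : V) (X' : {set V}) (pi : V -> seq V), [/\ X' \subset X, K <= #|X'| & star e c r X' pi].
Proof.
elim: r => [|r [N0 IH]].
  exists 2 => V e b X /card_gt1P[x [y [xX yX xy]]] H; move: xy.
  have [wx [_ <-]] := H x xX; rewrite leqn0 => /eqP/size0nil ->.
  by have [wy [_ <-]] := H y yX; rewrite leqn0 => /eqP/size0nil ->; rewrite eqxx.
(* One vertex [x0] carries the fixed path; the other [(r.+1 * N0).+1] paths meet its at most [r.+1]
   vertices, so more than [N0] of them share one. *)
have [M HM] := ramsey (r.+1 * N0).+2 K.
exists M => V e b X leX /[dup] H0.
have /choice[p0 Hp0] : forall x, exists w, x \in X -> [/\ path e b w, last b w = x & size w <= r.+1].
  by move=> x; have [/H0[w Hw]|] := boolP (x \in X); [exists w | exists [::]].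
move=> _.
have cs : symmetric (fun x y => has (mem (p0 x)) (p0 y)) by move=> x y; exact: has_sym.
have [[B BX [cB HB]]|[B BX [cB HB]]] := HM V _ X cs leX; last first.
  exists b, B, p0; split=> //; first by rewrite cB.
  by split=> [x xB|]; [apply: Hp0; apply: (fintype.subsetP BX) | exact: HB].
have /card_gt0P[x0 x0B] : 0 < #|B| by rewrite cB.
have := cardsD1 x0 B; rewrite x0B cB add1n => -[cB'].
have [_ _ s0] := Hp0 x0 (fintype.subsetP BX x0 x0B).
have /choice[g Hg] : forall x, exists w, x \in B :\ x0 -> w \in p0 x0 /\ w \in p0 x.
  move=> x; have [|_] := boolP (x \in _); last by exists x.
  rewrite !inE => /andP[ne xB]; have := HB x0 x x0B xB; rewrite eq_sym => /(_ ne)/hasP[w w1 w2].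
  by exists w.
have le : #|g @: (B :\ x0)| <= r.+1.
  apply: leq_trans s0; apply: leq_trans (card_size _).
  by apply: subset_leq_card; apply/fintype.subsetP => w /imsetP[x /Hg[? _] ->].
have [|v Hv] := @large_fiber _ _ (B :\ x0) g _ N0 le; first by rewrite -cB'.
have [|c [X' [pi [H1 H2 H3]]]] := IH V e v _ (ltnW Hv).
  move=> x; rewrite inE => /andP[xB /eqP gv]; have [_] := Hg x xB; rewrite gv => vx.
  move: xB; rewrite !inE => /andP[_ /(fintype.subsetP BX)/Hp0[pw lw sw]].
  case/splitPr: vx pw lw sw => p1 p2; rewrite cat_path last_cat size_cat /=.
  (* The part of the path behind [v] starts at [v] and is at least one entry shorter, since the list
     contains [v]. *)
  move=> /and3P[_ _ p] l s; exists p2; split=> //; lia.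
exists c, X', pi; split=> //.
  apply: fintype.subset_trans H1 _; apply/fintype.subsetP => x.
  by rewrite !inE => /andP[/andP[_ /(fintype.subsetP BX)]].
by case: H3 => H3 H4; split=> // x /H3[? ? ?]; split=> //; apply: leqW.
Qed.

(* As long as deleting the current centres leaves no large scattered set, Ramsey provides many
   vertices pairwise near each other, hence a further star. *)
Lemma scattered_or_stars r i M m : exists N, forall (V : finType) (e : rel V) (A : {set V}),
  symmetric e -> N <= #|A| ->
  (exists S B : {set V}, [/\ #|S| <= i, B \subset A, [disjoint B & S], m <= #|B| &
     scattered e S r B]) \/
  (exists (c : seq V) (X : {set V}) (pi : V -> V -> seq V),
     [/\ uniq c, size c = i, X \subset A, M <= #|X| &
      {in c, forall k, k \notin X /\ star e k r X (pi k)}]).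
Proof.
elim: i M => [|i IHi] M.
  by exists M => V e A _ leA; right; exists [::], A, (fun _ _ => [::]).
(* One vertex to spare: the new centre may lie in the new set and is then removed from it. *)
have [N1 H1] := star_exists r M.+1.
have [M1 HM1] := ramsey N1.+1 m.
have [N HN] := IHi M1.
exists N => V e A es leA.
have [[S [B [cS BA dS cB sc]]]|[c [X [pi [uc sc XA cX Hc]]]]] := HN V e A es leA.
  by left; exists S, B; split=> //; apply: leqW.
pose S := [set x in c].
have cS : #|S| <= i by rewrite cardsE -sc; apply: card_size.
have ns : symmetric (fun x y => `[< near e S r x y >]).
  by move=> x y; apply/asboolP/asboolP; apply: near_sym.
have [[B BX [cB HB]]|[B BX [cB HB]]] := HM1 V _ X ns cX; last first.
  left; exists S, B; split=> //; first exact: leqW.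
  - exact: fintype.subset_trans XA.
  - rewrite disjoint_subset; apply/fintype.subsetP => x /(fintype.subsetP BX) xX.
    by rewrite !inE; apply/negP => /Hc[]; rewrite xX.
  - by rewrite cB.
  - by move=> x y xB yB xy; have /asboolPn := HB x y xB yB xy.
right; have /card_gt0P[b bB] : 0 < #|B| by rewrite cB.
have := cardsD1 b B; rewrite bB cB add1n => -[cB'].
have [||c0 [X' [pi0 [X'B cX' st]]]] := H1 V (avoid e S) b (B :\ b).
- by rewrite -cB'.
- move=> x; rewrite !inE => /andP[ne xB]; have := HB b x bB xB; rewrite eq_sym => /(_ ne)/asboolP[_].
  exact.
have X'X : X' \subset X.
  by apply: fintype.subset_trans X'B _; apply: fintype.subset_trans BX; apply: subsetDl.
(* A nonempty path of the star starts outside [S]; an empty one makes [c0] an element of [X], which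
   contains no old centre. *)
have c0c : c0 \notin c.
  have /card_gt0P[x xX'] : 0 < #|X'| by apply: leq_trans cX'.
  have [/(_ x xX')[p l _] _] := st; case: (pi0 x) p l => [_ /= E|y w /= /andP[]]; last first.
    by rewrite /avoid !inE => /and3P[].
  by apply/negP => /Hc[/negP[]]; rewrite E (fintype.subsetP X'X).
exists (c0 :: c), (X' :\ c0), (fun k => if k == c0 then pi0 else pi k); split.
- by rewrite /= c0c.
- by rewrite /= sc.
- apply: fintype.subset_trans (fintype.subset_trans X'X XA); exact: subsetDl.
- by have := cardsD1 c0 X'; case: (c0 \in X') => /=; lia.
move=> k; rewrite inE; case: eqP => [-> _|_ /= /Hc[kX st']].
  split; first by rewrite !inE eqxx.
  apply: (star_subset (subsetDl _ _)); case: st => st1 st2; split=> // x /st1[p l s].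
  by split=> //; apply: sub_path p => y z /and3P[].
have sub : X' :\ c0 \subset X by apply: fintype.subset_trans X'X; apply: subsetDl.
split; last exact: star_subset st'.
by apply: contra kX => /(fintype.subsetP sub).
Qed.

Section QuasiWide.
Variables (C : graph -> Prop).
Hypotheses (HC : monotone_class C) (ndC : nowhere_dense C).

(* Two centres are joined through a vertex of [X] private to the pair, by a path whose length is at
   most [2 r]; a second application of Ramsey makes these lengths equal. *)
Lemma no_large_star_system (r : nat) : exists T M, forall (G : graph) (c : seq (gV G))
    (X : {set gV G}) (pi : gV G -> gV G -> seq (gV G)),
  C G -> uniq c -> size c = T -> M <= #|X| ->
  {in c, forall k, star (@gE G) k r X (pi k)} -> False.
Proof.
have [N HN] := choice ndC.
have [T HT] := ramsey_cover N (r + r).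
(* If [(T * r * T).+2] vertices had pairwise meeting path systems, a pigeonhole on the common vertex
   and on the centre would give two paths of one star that meet. In the disjoint case, [T] vertices
   are set aside for the systems that run through a centre, and [2 ^ T] remain, one for each set of
   centres. *)
have [M HM] := ramsey (T * r * T).+2 (2 ^ T + T).
exists T, M => G c X pi CG uc sc cX Hst.
have eS := @gE_sym G.
pose Y x := flatten [seq pi k x | k <- c].
have YP x w : w \in Y x -> exists2 k, k \in c & w \in pi k x.
  by move=> /flatten_mapP[k kc wk]; exists k.
have Ypi k x w : k \in c -> w \in pi k x -> w \in Y x.
  by move=> kc wk; apply/flatten_mapP; exists k.
have cs : symmetric (fun x y => has (mem (Y x)) (Y y)) by move=> x y; exact: has_sym.
have [[B BX [cB HB]]|[B BX [cB HB]]] := HM _ _ X cs cX.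
  have /card_gt0P[x0 x0B] : 0 < #|B| by rewrite cB.
  have := cardsD1 x0 B; rewrite x0B cB add1n => -[cB'].
  have /choice[g Hg] : forall x, exists wk, x \in B :\ x0 ->
      [/\ wk.1 \in Y x0, wk.2 \in c & wk.1 \in pi wk.2 x].
    move=> x; have [|_] := boolP (x \in _); last by exists (x, x).
    rewrite !inE => /andP[ne xB]; have := HB x0 x x0B xB; rewrite eq_sym.
    by move=> /(_ ne)/hasP[w /YP[k kc wk] w0]; exists (w, k).
  have le : #|g @: (B :\ x0)| <= T * r * T.
    apply: (@leq_trans #|setX [set w in Y x0] [set k in c]|).
      apply: subset_leq_card; apply/fintype.subsetP => u /imsetP[x /Hg[? ? _] ->].
      by rewrite !inE; apply/andP.
    rewrite cardsX !cardsE leq_mul //; last by rewrite -sc card_size.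
    apply: leq_trans (card_size _) _; rewrite size_flatten /shape -map_comp -sc.
    have : all (fun k => size (pi k x0) <= r) c.
      apply/allP => k kc; have [st _] := Hst k kc.
      by have [] := st x0 (fintype.subsetP BX x0 x0B).
    by elim: (c) => //= k c' IH /andP[? ?]; rewrite mulSn leq_add // IH.
  have [|v] := @large_fiber _ _ (B :\ x0) g _ 1 le; first by rewrite muln1 -cB'.
  move=> /card_gt1P[x [y []]]; rewrite !inE -!andbA => /and3P[nx xB /eqP gx] /and3P[ny yB /eqP gy] ne.
  have [|_ k1 w1] := Hg x; first by rewrite !inE nx.
  have [|_ k2 w2] := Hg y; first by rewrite !inE ny.
  rewrite gx in k1 w1; rewrite gy in w2.
  have [_ /(_ x y (fintype.subsetP BX x xB) (fintype.subsetP BX y yB) ne)/hasP[]] := Hst _ k1.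
  by exists v.1.
have disjY x y w : x \in B -> y \in B -> w \in Y x -> w \in Y y -> x = y.
  move=> xB yB wx wy; apply/eqP; apply/negPn/negP => ne.
  by have /hasP[] := HB x y xB yB ne; exists w.
(* Vertices whose paths run through a centre. The systems [Y x] being disjoint, each centre spoils
   at most one vertex. *)
pose bad := [set x in B | has (mem c) (Y x)].
have cbad : #|bad| <= T.
  have /choice[g Hg] : forall x, exists k, x \in bad -> k \in c /\ k \in Y x.
    move=> x; have [|_] := boolP (x \in _); last by exists x.
    by rewrite inE => /andP[_ /hasP[k kY kc]]; exists k.
  rewrite -(@card_in_imset _ _ g); last first.
    move=> x y xb yb E; have [_ gx] := Hg x xb; have [_ gy] := Hg y yb.
    move: xb yb; rewrite !inE => /andP[xB _] /andP[yB _].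
    by apply: (disjY x y (g x)) => //; rewrite E.
  rewrite -sc; apply: leq_trans (card_size c); apply: subset_leq_card.
  by apply/fintype.subsetP => k /imsetP[x /Hg[kc _] ->].
pose B0 := B :\: bad.
have B0B x : x \in B0 -> x \in B by rewrite inE => /andP[].
have B0c x k : x \in B0 -> k \in c -> k \notin Y x.
  rewrite !inE => /andP[+ xB] kc; rewrite xB /=; apply: contra => kY.
  by apply/hasP; exists k.
have cB0 : 2 ^ T <= #|B0|.
  have := cardsD B bad; rewrite (setIidPr _) ?cB; first by rewrite /B0; lia.
  by apply/fintype.subsetP => x; rewrite inE => /andP[].
have /card_gt0P[v0 _] : 0 < #|B0| by apply: leq_trans cB0; rewrite expn_gt0.
have card2 : #|{set 'I_T}| = 2 ^ T by rewrite card_subsets card_ord.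
(* The private vertex is indexed by a set of centres, so that it does not depend on the order of the
   pair [[set i; j]]. *)
pose h (Z : {set 'I_T}) := nth v0 (enum B0) (enum_rank Z).
have lth (Z : {set 'I_T}) : enum_rank Z < size (enum B0).
  by rewrite -cardE; apply: leq_trans cB0; rewrite -card2; apply: ltn_ord.
have hB0 Z : h Z \in B0 by rewrite -mem_enum mem_nth.
have hI : injective h.
  by move=> Z Z' /eqP; rewrite nth_uniq ?enum_uniq // => /eqP/val_inj/enum_rank_inj.
pose cc (i : 'I_T) := nth v0 c i.
have ccc i : cc i \in c by rewrite mem_nth // sc.
have ccI : injective cc by move=> i j /eqP; rewrite nth_uniq ?sc // => /eqP/val_inj.
pose conn (p : nat) (i j : 'I_T) (q : seq (gV G)) :=
  [/\ path (@gE G) (cc i) (rcons q (cc j)), size q = p, uniq q &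
      {subset q <= Y (h [set i; j])}].
pose e p i j := `[< exists q, conn p i j q >].
have es p : symmetric (e p).
  suff imp i j : e p i j -> e p j i by move=> i j; apply/idP/idP; apply: imp.
  move=> /asboolP[q [pq sq uq qY]]; apply/asboolP; exists (rev q); split.
  - rewrite -rev_cons -(belast_rcons (cc i) q (cc j)) -[X in path _ X](last_rcons (cc i) q (cc j)).
    by rewrite rev_path_sym.
  - by rewrite size_rev.
  - by rewrite rev_uniq.
  - by move=> x; rewrite mem_rev setUC; apply: qY.
have cov : {in [set: 'I_T] &, forall i j, i != j -> exists2 p, p < r + r & e p i j}.
  move=> i j _ _ ij; pose x := h [set i; j].
  have xX : x \in X by apply: (fintype.subsetP BX); apply: B0B (hB0 _).
  have [/(_ x xX)[p1 l1 s1] _] := Hst _ (ccc i).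
  have [/(_ x xX)[p2 l2 s2] _] := Hst _ (ccc j).
  (* From [cc i] to [x], then back to [cc j]. Shortened to a simple path it has at most [r + r]
     entries, the last of which is [cc j], so there are fewer than [r + r] inner vertices. *)
  pose w := pi (cc i) x ++ rev (belast (cc j) (pi (cc j) x)).
  have pw : path (@gE G) (cc i) w.
    by rewrite cat_path p1 l1 -[X in path _ X _]l2 rev_path_sym.
  have lw : last (cc i) w = cc j.
    by rewrite last_cat l1 -[X in last X _]l2 last_rev_belast.
  have wY u : u \in w -> u != cc j -> u \in Y x.
    rewrite mem_cat mem_rev => /orP[/Ypi->//|].
    by move=> /mem_belast; rewrite inE => /orP[->//|/Ypi->].
  have sw : size w <= r + r by rewrite size_cat size_rev size_belast leq_add.
  case/shortenP: pw lw => w' pw' uw' sub lw.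
  have sw' : size w' <= r + r.
    by apply: leq_trans sw; apply: uniq_leq_size; [case/andP: uw' | exact: sub].
  case: (lastP w') => [|q y] in lw uw' pw' sub sw' *.
    by move: ij; rewrite -(inj_eq ccI) -lw eqxx.
  rewrite last_rcons in lw; subst y; exists (size q); first by rewrite size_rcons in sw'.
  move: uw'; rewrite /= rcons_uniq => /and3P[_ jq uq].
  apply/asboolP; exists q; split=> // u uq'; apply: wY.
    by apply: sub; rewrite mem_rcons inE uq' orbT.
  by apply: contraNneq jq => <-.
have [|p pr [Z _ [cZ HZ]]] := HT _ e [set: 'I_T] es _ cov; first by rewrite cardsT card_ord.
apply: (HN p); apply: (HC CG).
pose io (i : 'I_(N p)) : 'I_T := enum_val (cast_ord (esym cZ) i).
have ioI : injective io by move=> i j /enum_val_inj/cast_ord_inj.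
have /choice[q Hq] : forall ij : 'I_(N p) * 'I_(N p), exists q, ij.1 < ij.2 ->
    conn p (io ij.1) (io ij.2) q.
  move=> [i j] /=; case: (boolP (i < j)) => [ij|_]; last by exists [::].
  have /asboolP[q Hq] : e p (io i) (io j).
    apply: HZ; try exact: enum_valP.
    by rewrite (inj_eq ioI); apply/eqP => E; rewrite E ltnn in ij.
  by exists q.
apply: (@subdivision_embeds G _ _ (fun i => cc (io i)) (fun i j => q (i, j))).
- by move=> i j /ccI/ioI.
- move=> i j ij; have [pq sq uq qY] := Hq (i, j) ij; split=> // k.
  by apply: contra (B0c _ _ (hB0 [set io i; io j]) (ccc (io k))); apply: qY.
move=> i j i' j' x ij ij' xq xq'.
have [_ _ _ /(_ x xq) xY] := Hq (i, j) ij; have [_ _ _ /(_ x xq') xY'] := Hq (i', j') ij'.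
have /hI/setP E := disjY _ _ x (B0B _ (hB0 _)) (B0B _ (hB0 _)) xY xY'.
have := E (io i); have := E (io j); have := E (io i'); have := E (io j').
rewrite !inE !(inj_eq ioI) !eqxx ?orbT /=.
by do 4!case: eqP => // ? /=; subst; rewrite ?ltnn // in ij ij' *; lia.
Qed.

(** The bound [s] is a number of star centres that the class cannot support, hence it is known
    before [m]. *)
Lemma uniformly_quasi_wide (r : nat) : exists s, forall m, exists N, forall G, C G ->
  forall A : {set gV G}, N <= #|A| -> exists S B : {set gV G},
  [/\ #|S| <= s, B \subset A, [disjoint B & S], m <= #|B| & scattered (@gE G) S r B].
Proof.
have [T [M HM]] := no_large_star_system r.
exists T => m; have [N HN] := scattered_or_stars r T M m.
exists N => G CG A leA.
have [//|[c [X [pi [uc sc _ cX Hc]]]]] := HN _ (@gE G) A (@gE_sym G) leA.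
by case: (HM G c X pi CG uc sc cX) => k /Hc[].
Qed.
End QuasiWide.

Section TupleQuasiWide.
Variables (C : graph -> Prop).
Hypotheses (HC : monotone_class C) (ndC : nowhere_dense C).

(** Induction on the coordinates. If the new coordinate takes many values, quasi-wideness applies to
    the set of values. Otherwise many tuples share one value, and deleting this single vertex
    settles the coordinate, since a deleted vertex is near nothing. *)
Lemma coordinatewise_quasi_wide (n r : nat) : exists s, forall m, exists N, forall G, C G ->
  forall (I : finType) (a : I -> nat -> gV G), N <= #|I| ->
  exists (S : {set gV G}) (J : {set I}), [/\ #|S| <= s, m <= #|J| &
    {in J &, forall l l', l != l' -> forall x, x < n -> ~ near (@gE G) S r (a l x) (a l' x)}].
Proof.
elim: n => [|n [s H]].
  by exists 0 => m; exists m => G _ I a leI; exists set0, [set: I]; rewrite cards0 cardsT.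
have [s1 H1'] := uniformly_quasi_wide HC ndC r.
exists (s + s1).+1 => m; have [N1 H1] := H1' m; have {H}[N H] := H (N1 * m).+1.
exists N => G CG I a leI.
have [S [J [cS leJ HJ]]] := H G CG I a leI.
have wrap (S' : {set gV G}) (J' : {set I}) : #|S'| <= s1.+1 -> m <= #|J'| -> J' \subset J ->
    {in J' &, forall l l', l != l' -> ~ near (@gE G) S' r (a l n) (a l' n)} ->
    exists (S : {set gV G}) (J : {set I}), [/\ #|S| <= (s + s1).+1, m <= #|J| &
    {in J &, forall l l', l != l' -> forall x, x < n.+1 -> ~ near (@gE G) S r (a l x) (a l' x)}].
  move=> cS' cJ' sJ' HJ'; exists (S :|: S'), J'; split=> //.
    by apply: leq_trans (leq_card_setU _ _) _; rewrite -addnS leq_add.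
  move=> l l' lJ lJ' ll' x; rewrite ltnS leq_eqVlt => /orP[/eqP ->|lt].
    by move/(near_subset (subsetUr _ _)); apply: HJ'.
  by move/(near_subset (subsetUl _ _)); apply: HJ => //; apply: (fintype.subsetP sJ').
pose f l := a l n.
have [le|lt] := leqP N1 #|f @: J|.
  have [S' [B [cS' BA dB cB scB]]] := H1 G CG _ le.
  have /choice[g Hg] : forall v, exists l, v \in B -> l \in J /\ f l = v.
    move=> v; have [vB|] := boolP (v \in B); last by
      have /card_gt0P[l _] : 0 < #|J| by [apply: leq_trans leJ]; exists l.
    by have /imsetP[l lJ ->] := fintype.subsetP BA v vB; exists l.
  apply: (wrap S' (g @: B)); first exact: leqW.
  - by rewrite card_in_imset // => u v /Hg[_ {2}<-] /Hg[_ {2}<-] ->.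
  - by apply/fintype.subsetP => l /imsetP[v /Hg[? _] ->].
  move=> l l' /imsetP[v vB ->] /imsetP[v' vB' ->] ne.
  rewrite -!/(f _); have [_ ->] := Hg v vB; have [_ ->] := Hg v' vB'; apply: scB => //.
  by apply: contraNneq ne => ->.
have [v Hv] := large_fiber (leqnn _) (leq_ltn_trans (leq_mul (ltnW lt) (leqnn m)) leJ).
apply: (wrap [set v] _ _ (ltnW Hv)); first by rewrite cards1.
  by apply/fintype.subsetP => l; rewrite inE => /andP[].
move=> l l'; rewrite inE => /andP[_ /eqP E] _ _ /(near_notin (@gE_sym G))[].
by rewrite -/(f l) E set11.
Qed.

(** Different coordinates are compared by Ramsey. Among many pairwise close tuples, a pigeonhole on
    pairs of coordinates finds two tuples whose entries at one index are both near the same entry of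
    a third, hence within [r + r] of each other, against the coordinatewise version. *)
Lemma tuple_quasi_wide (n r : nat) : exists s, forall m, exists N, forall G, C G ->
  forall (I : finType) (a : I -> nat -> gV G), N <= #|I| ->
  exists (S : {set gV G}) (J : {set I}), [/\ #|S| <= s, m <= #|J| &
    {in J &, forall l l', l != l' -> forall x x', x < n -> x' < n ->
       ~ near (@gE G) S r (a l x) (a l' x')}].
Proof.
have [s H'] := coordinatewise_quasi_wide n (r + r).
exists s => m; have [M HM] := ramsey (n * n).+2 m; have [N H] := H' M.
exists N => G CG I a leI; have [S [J [cS leJ HJ]]] := H G CG I a leI.
have eS := @gE_sym G.
pose bad l l' := [exists x : 'I_n, exists x' : 'I_n, `[< near (@gE G) S r (a l x) (a l' x') >]].
have badS : symmetric bad.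
  suff imp l l' : bad l l' -> bad l' l by move=> l l'; apply/idP/idP; apply: imp.
  move=> /existsP[x /existsP[x' /asboolP nr]]; apply/existsP; exists x'; apply/existsP; exists x.
  by apply/asboolP; apply: near_sym.
exists S; have [[B BJ [cB Hcl]]|[B BJ [cB Hin]]] := HM I bad J badS leJ; last first.
  exists B; split=> //; first by rewrite cB.
  move=> l l' lB lB' ll' x x' xn xn' nr; have /negP := Hin l l' lB lB' ll'; apply.
  by apply/existsP; exists (Ordinal xn); apply/existsP; exists (Ordinal xn'); apply/asboolP.
exfalso.
have /card_gt0P[l0 l0B] : 0 < #|B| by rewrite cB.
have := cardsD1 l0 B; rewrite l0B cB add1n => -[cB'].
pose B' := B :\ l0.
(* The option type supplies a value outside [B'] even when [n] is 0. *)
have /choice[g Hg] : forall l, exists c : option ('I_n * 'I_n), l \in B' ->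
    exists xx, c = Some xx /\ near (@gE G) S r (a l0 xx.1) (a l xx.2).
  move=> l; have [lB|] := boolP (l \in B'); last by exists None.
  move: lB; rewrite !inE => /andP[ne lB].
  have /existsP[x /existsP[x' /asboolP nr]] : bad l0 l by apply: Hcl => //; rewrite eq_sym.
  by exists (Some (x, x')) => _; exists (x, x').
have le : #|g @: B'| <= n * n.
  apply: (@leq_trans #|[set Some xx | xx in [set: 'I_n * 'I_n]]|); last first.
    by apply: leq_trans (leq_imset_card _ _) _; rewrite cardsT card_prod !card_ord.
  apply: subset_leq_card; apply/fintype.subsetP => c /imsetP[l /Hg[xx [-> _]] ->].
  by apply/imsetP; exists xx.
have [|v] := @large_fiber _ _ B' g _ 1 le; first by rewrite muln1 -cB'.
move=> /card_gt1P[l1 [l2 []]]; rewrite !inE -!andbA => /and3P[n1 B1 /eqP g1] /and3P[n2 B2 /eqP g2] ne.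
have [|xx1 [E1 N1]] := Hg l1; first by rewrite !inE n1.
have [|xx2 [E2 N2]] := Hg l2; first by rewrite !inE n2.
have E : xx1 = xx2 by move: E1 E2; rewrite g1 g2 => -> [].
subst xx2; apply: (HJ l1 l2 _ _ ne _ (ltn_ord xx1.2)); try exact: (fintype.subsetP BJ).
by apply: near_trans N2; apply: near_sym.
Qed.
End TupleQuasiWide.

(** * Locality of first-order formulas *)

Section Locality.
Variables (V : finType) (e : rel V) (S : {set V}) (n k : nat).
Hypotheses (e_sym : symmetric e) (cardS : #|S| <= k).
Implicit Types (X : pred nat) (a b : nat -> V) (z : V).

Definition mix X a b : nat -> V := fun i => if X i then a i else b i.
Definition addx X i : pred nat := fun j => (j == i) || X j.
Definition delx X i : pred nat := fun j => (j != i) && X j.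

Definition atomic_type : finType :=
  ({set 'I_n * 'I_n} * {set 'I_n * 'I_n} * {set 'I_n * 'I_k} * {set 'I_n * 'I_k})%type.

(* A type of rank [q.+1] records, besides the atomic type over [S], the types of rank [q] of the
   tuple with one entry dropped, and for each vertex close to the tuple the types of rank [q] of the
   extended tuple and of the new vertex alone. *)
Fixpoint ltype (q : nat) : finType :=
  if q is q'.+1
  then (atomic_type * {ffun 'I_n -> ltype q'} * {set 'I_n * ltype q' * ltype q'})%type
  else atomic_type.

Definition atom X a : atomic_type :=
  ([set p : 'I_n * 'I_n | [&& X p.1, X p.2 & a p.1 == a p.2]],
   [set p : 'I_n * 'I_n | [&& X p.1, X p.2 & e (a p.1) (a p.2)]],
   [set p : 'I_n * 'I_k | X p.1 && (onth (enum S) p.2 == Some (a p.1))],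
   [set p : 'I_n * 'I_k | X p.1 && oapp (e (a p.1)) false (onth (enum S) p.2)]).

Definition near_tuple r X a z := [exists x : 'I_n, X x && `[< near e S r z (a x) >]].

Fixpoint typ q X a : ltype q :=
  match q return ltype q with
  | 0 => atom X a
  | q'.+1 => (atom X a, [ffun i : 'I_n => typ q' (delx X i) a],
      [set u : 'I_n * ltype q' * ltype q' | [exists z, near_tuple (2 ^ q') X a z &&
         (u == (u.1.1, typ q' (addx X u.1.1) (upd a u.1.1 z),
                typ q' (pred1 (u.1.1 : nat)) (upd a u.1.1 z)))]])
  end.

Lemma typ_atom q X a a' : typ q X a = typ q X a' -> atom X a = atom X a'.
Proof. by case: q => [|q] //= /(congr1 (fun u => u.1.1)). Qed.

Lemma near_tupleP r X a z :
  reflect (exists2 x, x < n & X x /\ near e S r z (a x)) (near_tuple r X a z).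
Proof.
apply: (iffP existsP) => [[x /andP[Xx /asboolP nz]]|[x xn [Xx nz]]]; first by exists x.
by exists (Ordinal xn); rewrite Xx; apply/asboolP.
Qed.

Definition far r X a b := forall x y, x < n -> y < n -> X x -> ~~ X y -> ~ near e S r (a x) (b y).

Definition spread (I : finType) r X (a : I -> nat -> V) :=
  forall l l', l != l' -> forall x x', x < n -> x' < n -> X x -> X x' ->
  ~ near e S r (a l x) (a l' x').

(** Each of the [n] entries of [b] is within [r] of at most one tuple, since two such tuples would
    be within [r + r] of each other. *)
Lemma spread_far_exists (I : finType) r X (a : I -> nat -> V) b (L : {set I}) :
  spread (r + r) X a -> n < #|L| -> exists2 l, l \in L & far r X (a l) b.
Proof.
move=> spr ltL; apply: contrapT => no.
have /choice[g Hg] : forall l, exists y : option 'I_n, l \in L ->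
    exists x y', [/\ x < n, X x, y = Some y' & near e S r (a l x) (b y')].
  move=> l; have [lL|] := boolP (l \in L); last by exists None.
  apply: contrapT => nex; apply: no; exists l => // x y xn yn Xx _ nr.
  by apply: nex; exists (Some (Ordinal yn)) => _; exists x, (Ordinal yn).
have le : #|g @: L| <= n.
  apply: (@leq_trans #|[set Some x | x in [set: 'I_n]]|); last first.
    by apply: leq_trans (leq_imset_card _ _) _; rewrite cardsT card_ord.
  apply: subset_leq_card; apply/fintype.subsetP => c /imsetP[l /Hg[x [y [_ _ -> _]]] ->].
  by apply/imsetP; exists y.
have [|v] := @large_fiber _ _ L g _ 1 le; first by rewrite muln1.
move=> /card_gt1P[l1 [l2 []]]; rewrite !inE => /andP[L1 /eqP g1] /andP[L2 /eqP g2] ne.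
have [x1 [y1 [xn1 X1 E1 N1]]] := Hg _ L1; have [x2 [y2 [xn2 X2 E2 N2]]] := Hg _ L2.
have E : y1 = y2 by move: E1 E2; rewrite g1 g2 => -> [].
subst y2; apply: (spr l1 l2 ne x1 x2) => //.
by apply: near_trans N1 _; apply: near_sym.
Qed.

(* With at least [n.+3] tuples, there is always one far from [b] besides two given ones. *)
Definition local q (H : (nat -> V) -> bool) :=
  forall (I : finType) X (a : I -> nat -> V) b, n.+3 <= #|I| ->
  (forall l l', typ q X (a l) = typ q X (a l')) -> spread (4 * 2 ^ q) X a ->
  forall i j, far (2 ^ q) X (a i) b -> far (2 ^ q) X (a j) b ->
  H (mix X (a i) b) -> H (mix X (a j) b).

Lemma onth_enum v : v \in S -> exists t : 'I_k, onth (enum S) t = Some v.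
Proof.
move=> vS; have lt : index v (enum S) < #|S| by rewrite cardE index_mem mem_enum.
exists (Ordinal (leq_trans lt cardS)) => /=.
by rewrite onthE (nth_map v) -?cardE // nth_index // mem_enum.
Qed.

Section AtomicTransfer.
Variables (X : pred nat) (a a' : nat -> V).
Hypothesis eqt : atom X a = atom X a'.

Lemma atom_eq x y : x < n -> y < n -> X x -> X y -> (a x == a y) = (a' x == a' y).
Proof.
move=> xn yn Xx Xy; case: eqt => /setP/(_ (Ordinal xn, Ordinal yn)) + _ _ _.
by rewrite !inE /= Xx Xy.
Qed.

Lemma atom_adj x y : x < n -> y < n -> X x -> X y -> e (a x) (a y) = e (a' x) (a' y).
Proof.
move=> xn yn Xx Xy; case: eqt => _ /setP/(_ (Ordinal xn, Ordinal yn)) + _ _.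
by rewrite !inE /= Xx Xy.
Qed.

Lemma atom_const x : x < n -> X x -> a x \in S -> a' x = a x.
Proof.
move=> xn Xx /onth_enum[t Et]; case: eqt => _ _ /setP/(_ (Ordinal xn, t)) + _.
by rewrite !inE /= Xx Et eqxx /= => /esym/eqP[].
Qed.

Lemma atom_adj_const x v : x < n -> X x -> v \in S -> e (a x) v = e (a' x) v.
Proof.
move=> xn Xx /onth_enum[t Et]; case: eqt => _ _ _ /setP/(_ (Ordinal xn, t)).
by rewrite !inE /= Xx Et.
Qed.

End AtomicTransfer.

Lemma local_eq q x y : x < n -> y < n -> local q (fun c => c x == c y).
Proof.
move=> xn yn I X a b _ eqt _ i j fi fj; rewrite /mix.
have /typ_atom eqa := eqt i j.
(* Outside [S] an equality contradicts farness at distance 0; inside [S] the type fixes the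
   value. *)
have mixed u v : u < n -> v < n -> X u -> ~~ X v -> a i u = b v -> a j u = b v.
  move=> un vn Xu Xv E; have [uS|uS] := boolP (a i u \in S).
    by rewrite (atom_const eqa un Xu uS).
  by case: (fi u v un vn Xu Xv); rewrite -E; apply: near_refl.
have [Xx|Xx] := boolP (X x); have [Xy|Xy] := boolP (X y) => //.
- by rewrite (atom_eq eqa).
- by move=> /eqP/(mixed x y xn yn Xx Xy)/eqP.
- by rewrite eq_sym => /eqP/(mixed y x yn xn Xy Xx)/eqP; rewrite eq_sym.
Qed.

Lemma local_adj q x y : x < n -> y < n -> local q (fun c => e (c x) (c y)).
Proof.
move=> xn yn I X a b _ eqt _ i j fi fj; rewrite /mix.
have /typ_atom eqa := eqt i j.
(* If an end of the edge lies in [S], the type decides; otherwise the edge is a path of length 1,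
   against farness. *)
have mixed u v : u < n -> v < n -> X u -> ~~ X v -> e (a i u) (b v) -> e (a j u) (b v).
  move=> un vn Xu Xv E; have [uS|uS] := boolP (a i u \in S).
    by rewrite (atom_const eqa un Xu uS).
  have [vS|vS] := boolP (b v \in S); first by rewrite -(atom_adj_const eqa).
  case: (fi u v un vn Xu Xv); apply: (@near_le _ _ _ 1); first by rewrite expn_gt0.
  exact: near_edge.
have [Xx|Xx] := boolP (X x); have [Xy|Xy] := boolP (X y) => //.
- by rewrite (atom_adj eqa).
- exact: mixed.
- by rewrite e_sym => /(mixed y x yn xn Xy Xx); rewrite e_sym.
Qed.

(** Contraposition exchanges [i] and [j]; this is why [local] is an implication required for all
    ordered pairs. *)
Lemma local_not q H : local q H -> local q (fun c => ~~ H c).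
Proof.
move=> lH I X a b cI eqt spr i j fi fj; apply: contra.
by apply: lH.
Qed.

Lemma local_and q H H' : local q H -> local q H' -> local q (fun c => H c && H' c).
Proof.
move=> lH lH' I X a b cI eqt spr i j fi fj /andP[h h'].
by apply/andP; split; [apply: lH h | apply: lH' h'].
Qed.

Lemma local_ext q H H' : H =1 H' -> local q H -> local q H'.
Proof. by move=> /funext ->. Qed.

Lemma upd_mix_in X a b v z : upd (mix X a b) v z = mix (addx X v) (upd a v z) b.
Proof. by apply: funext => j; rewrite /upd /mix /addx; case: eqP => //. Qed.

Lemma upd_mix_out X a b v z : upd (mix X a b) v z = mix (delx X v) a (upd b v z).
Proof. by apply: funext => j; rewrite /upd /mix /delx; case: eqP => //. Qed.

Lemma upd_mix1 a c v z : upd c v z = mix (pred1 v) (upd a v z) c.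
Proof. by apply: funext => j; rewrite /upd /mix /=; case: eqP => //. Qed.

Lemma typ_near_ext q X a a' v z : v < n -> typ q.+1 X a = typ q.+1 X a' ->
  near_tuple (2 ^ q) X a z -> exists z', [/\ near_tuple (2 ^ q) X a' z',
    typ q (addx X v) (upd a v z) = typ q (addx X v) (upd a' v z') &
    typ q (pred1 v) (upd a v z) = typ q (pred1 v) (upd a' v z')].
Proof.
move=> vn /(congr1 snd) E nz; pose i := Ordinal vn.
have : (i, typ q (addx X i) (upd a i z), typ q (pred1 (i : nat)) (upd a i z))
    \in (typ q.+1 X a).2.
  by rewrite inE; apply/existsP; exists z; rewrite nz eqxx.
rewrite E inE /=.
by move=> /existsP[z' /andP[nz' /eqP[E1 E2]]]; exists z'.
Qed.

Lemma typ_del q X a a' v : v < n -> typ q.+1 X a = typ q.+1 X a' ->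
  typ q (delx X v) a = typ q (delx X v) a'.
Proof.
by move=> vn /(congr1 (fun u => u.1.2))/ffunP/(_ (Ordinal vn)); rewrite !ffunE.
Qed.

(** The witness [z] joins the side to which it is close. Near [a i] it becomes an entry of the
    tuple, and the types give the other tuples counterparts of it; near neither tuple it becomes an
    entry of [b]. An extended tuple stays within [2 ^ q] of the old one, so farness needs
    [2 ^ q + 2 ^ q], and spread needs [4 * 2 ^ q] plus twice [2 ^ q], which is below
    [4 * 2 ^ q.+1]. *)
Lemma local_exists q v H : v < n -> local q H ->
  local q.+1 (fun c => [exists z, H (upd c v z)]).
Proof.
move=> vn lH I X a b cI eqt spr i j fi fj /existsP[z Hz]; apply/existsP.
have le2 : 2 ^ q <= 2 ^ q.+1 by rewrite leq_exp2l.
have e2 : 2 ^ q.+1 = 2 ^ q + 2 ^ q by rewrite expnS mul2n addnn.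
pose fam i0 z0 (zz : I -> V) := [/\ zz i0 = z0,
  forall l, near_tuple (2 ^ q) X (a l) (zz l),
  forall l l', typ q (addx X v) (upd (a l) v (zz l)) = typ q (addx X v) (upd (a l') v (zz l')) &
  forall l l', typ q (pred1 v) (upd (a l) v (zz l)) = typ q (pred1 v) (upd (a l') v (zz l'))].
have mkfam i0 z0 : near_tuple (2 ^ q) X (a i0) z0 -> exists zz, fam i0 z0 zz.
  move=> nz; have /choice[zz Hzz] : forall l, exists z', [/\ l = i0 -> z' = z0,
      near_tuple (2 ^ q) X (a l) z',
      typ q (addx X v) (upd (a i0) v z0) = typ q (addx X v) (upd (a l) v z') &
      typ q (pred1 v) (upd (a i0) v z0) = typ q (pred1 v) (upd (a l) v z')].
    move=> l; have [->|ne] := eqVneq l i0; first by exists z0.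
    have [z' [? ? ?]] := typ_near_ext vn (eqt i0 l) nz.
    by exists z'; split=> // E; rewrite E eqxx in ne.
  exists zz; split.
  - by have [->] := Hzz i0.
  - by move=> l; have [] := Hzz l.
  - by move=> l l'; have [_ _ <- _] := Hzz l; have [_ _ <- _] := Hzz l'.
  - by move=> l l'; have [_ _ _ <-] := Hzz l; have [_ _ _ <-] := Hzz l'.
have spr_le r : r <= 4 * 2 ^ q.+1 -> spread r X a.
  by move=> le l l' ll' x x' xn xn' Xx Xx' nr; apply: (spr l l' ll' x x') => //; apply: near_le nr.
have [nzi|nzi] := boolP (near_tuple (2 ^ q) X (a i) z).
  have [zz [Ei nzz t1 _]] := mkfam i z nzi.
  pose a' l := upd (a l) v (zz l).
  have anchor l x w r : x < n -> addx X v x -> near e S r (a' l x) w ->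
      exists2 x0, x0 < n & X x0 /\ near e S (2 ^ q + r) (a l x0) w.
    rewrite /a' /addx /upd; case: eqP => [_ _ _ nw|_ xn Xx nw].
      have /near_tupleP[x0 xn0 [Xx0 n0]] := nzz l.
      by exists x0 => //; split=> //; apply: near_trans nw; apply: near_sym.
    by exists x => //; split=> //; apply: near_le nw; apply: leq_addl.
  exists (zz j); rewrite upd_mix_in; rewrite -Ei upd_mix_in in Hz.
  apply: (lH I (addx X v) a' b cI) Hz => //.
  - move=> l l' ll' x x' xn xn' Xx Xx' /(anchor _ _ _ _ xn Xx)[x0 xn0 [X0]].
    move=> /(near_sym e_sym)/(anchor _ _ _ _ xn' Xx')[x1 xn1 [X1 n1]].
    apply: (spr l l' ll' x0 x1) => //; apply: near_sym => //; apply: near_le n1.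
    by rewrite e2; lia.
  - move=> x y xn yn Xx; rewrite /addx negb_or => /andP[_ Xy].
    move=> /(anchor _ _ _ _ xn Xx)[x0 xn0 [X0 n0]].
    by apply: (fi x0 y) => //; rewrite e2.
  - move=> x y xn yn Xx; rewrite /addx negb_or => /andP[_ Xy].
    move=> /(anchor _ _ _ _ xn Xx)[x0 xn0 [X0 n0]].
    by apply: (fj x0 y) => //; rewrite e2.
have out c : far (2 ^ q.+1) X c b -> forall z', ~~ near_tuple (2 ^ q) X c z' ->
    far (2 ^ q) (delx X v) c (upd b v z').
  move=> fc z' nz' x y xn yn /andP[_ Xx]; rewrite /delx /upd; case: eqP => [_ _|_ /= Xy] nxy.
    by move/negP: nz'; apply; apply/near_tupleP; exists x => //; split=> //; apply: near_sym.
  by apply: (fc x y) => //; apply: near_le nxy.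
(* The variable [v] now belongs to the side of [b], so the tuples lose their entry [v]; this is what
   the types of shortened tuples are for. *)
have move_out z' : ~~ near_tuple (2 ^ q) X (a i) z' -> ~~ near_tuple (2 ^ q) X (a j) z' ->
    H (upd (mix X (a i) b) v z') -> H (upd (mix X (a j) b) v z').
  move=> ni nj; rewrite !upd_mix_out; apply: (lH I) => //.
  - by move=> l l'; apply: typ_del.
  - move=> l l' ll' x x' xn xn' /andP[_ Xx] /andP[_ Xx'].
    by apply: (@spr_le (4 * 2 ^ q)) => //; rewrite leq_mul2l.
  - exact: out.
  - exact: out.
have [nzj|nzj] := boolP (near_tuple (2 ^ q) X (a j) z); last by exists z; apply: move_out.
(* [z] is close to [a j] only: replace it by its counterpart close to a third, remote tuple. *)
have [zz [Ej nzz _ t1]] := mkfam j z nzj.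
have [l lij fl] : exists2 l, l \in [set~ i] :\ j & far (2 ^ q.+1) X (a l) b.
  apply: spread_far_exists; first by apply: spr_le; lia.
  have := cardsC1 i; have := cardsD1 j [set~ i]; case: (j \in _); lia.
move: lij; rewrite !inE => /andP[lj li].
have remote l' : l' != l -> ~~ near_tuple (2 ^ q) X (a l') (zz l).
  move=> ne; apply/near_tupleP => -[x xn [Xx n1]].
  have /near_tupleP[x0 xn0 [X0 n0]] := nzz l.
  have le : 2 ^ q + 2 ^ q <= 4 * 2 ^ q.+1 by lia.
  apply: (spr_le _ le l' l ne x x0) => //.
  by apply: near_trans n0; apply: near_sym.
exists (zz l); apply: move_out; [apply: remote | apply: remote |]; rewrite 1?eq_sym //.
(* Locality is used for the one-vertex tuples [zz], with [a i] and [b] together as parameters: this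
   trades [z] for [zz l] while [a i] stays. As [zz l] is near neither [a i] nor [a j], [move_out]
   then exchanges these two. *)
rewrite (upd_mix1 (a l)); rewrite -Ej (upd_mix1 (a j)) in Hz.
have far_new l' : ~~ near_tuple (2 ^ q) X (a i) (zz l') -> far (2 ^ q.+1) X (a l') b ->
    far (2 ^ q) (pred1 v) (upd (a l') v (zz l')) (mix X (a i) b).
  move=> ni fl' x y xn yn /= /eqP -> ne; rewrite /upd eqxx /mix.
  case: (boolP (X y)) => Xy n1.
    by move/negP: ni; apply; apply/near_tupleP; exists y.
  have /near_tupleP[x0 xn0 [X0 n0]] := nzz l'.
  apply: (fl' x0 y) => //; rewrite e2; apply: near_trans n1; exact: near_sym.
apply: (lH I (pred1 v) (fun l => upd (a l) v (zz l)) _ cI) Hz => //.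
- move=> l1 l2 ne x x' _ _ /= /eqP -> /eqP ->; rewrite /upd eqxx => nz.
  have /near_tupleP[x1 xn1 [X1 n1]] := nzz l1.
  have /near_tupleP[x2 xn2 [X2 n2]] := nzz l2.
  have le : 2 ^ q + 4 * 2 ^ q + 2 ^ q <= 4 * 2 ^ q.+1 by lia.
  apply: (spr_le _ le l1 l2 ne x1 x2) => //.
  by apply: near_trans n2; apply: near_trans nz; apply: near_sym.
- by apply: far_new => //; rewrite Ej.
- by apply: far_new => //; apply: remote; rewrite eq_sym.
Qed.

(** Bound variables count too: a quantifier overwrites the assignment at its own index, and types
    see only indices below [n]. *)
Fixpoint bounded_vars (f : fo) : bool :=
  match f with
  | FAdj i j | FEq i j => (i < n) && (j < n)
  | FNot g => bounded_vars g
  | FAnd g h | FOr g h => bounded_vars g && bounded_vars h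
  | FEx i g | FAll i g => (i < n) && bounded_vars g
  end.

Fixpoint qrank (f : fo) : nat :=
  match f with
  | FAdj _ _ | FEq _ _ => 0
  | FNot g => qrank g
  | FAnd g h | FOr g h => maxn (qrank g) (qrank h)
  | FEx _ g | FAll _ g => (qrank g).+1
  end.

Lemma local_holds f q : bounded_vars f -> qrank f <= q -> local q (fun c => holds e c f).
Proof.
elim: f q => [i j|i j|g IH|g IHg h IHh|g IHg h IHh|i g IH|i g IH] q /=.
- by move=> /andP[? ?] _; apply: local_adj.
- by move=> /andP[? ?] _; apply: local_eq.
- by move=> ? ?; apply: local_not; apply: IH.
- by move=> /andP[? ?]; rewrite geq_max => /andP[? ?]; apply: local_and; [apply: IHg | apply: IHh].
- move=> /andP[? ?]; rewrite geq_max => /andP[? ?].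
  apply: (@local_ext _ (fun c => ~~ (~~ holds e c g && ~~ holds e c h))).
    by move=> c; rewrite negb_and !negbK.
  by apply: local_not; apply: local_and; apply: local_not; [apply: IHg | apply: IHh].
- case: q => // q /andP[vn bg] rg; apply: (@local_exists _ _ (fun c => holds e c g)) => //.
  exact: IH.
- case: q => // q /andP[vn bg] rg.
  apply: (@local_ext _ (fun c => ~~ [exists z, ~~ holds e (upd c i z) g])).
    by move=> c; rewrite negb_exists; apply: eq_forallb => z; rewrite negbK.
  apply: local_not; apply: (@local_exists _ _ (fun c => ~~ holds e c g)) => //.
  by apply: local_not; apply: IH.
Qed.

End Locality.

(** * Shattering *)

Lemma bounded_vars_exists f : exists n, bounded_vars n f.
Proof.
suff [n Hn] : exists n, forall m, n <= m -> bounded_vars m f by exists n; apply: Hn.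
elim: f => [i j|i j|g [n IH]|g [n IHg] h [n' IHh]|g [n IHg] h [n' IHh]|i g [n IH]|i g [n IH]];
  rewrite /=; [exists (maxn i j).+1 | exists (maxn i j).+1 | exists n | exists (maxn n n')
  | exists (maxn n n') | exists (maxn i.+1 n) | exists (maxn i.+1 n)] => m;
  rewrite ?gtn_max ?geq_max //; try by move=> /andP[? ?]; rewrite ?IHg ?IHh ?IH // andbT.
exact: IH.
Qed.

Section NotShattered.
Variables (C : graph -> Prop).
Hypotheses (HC : monotone_class C) (ndC : nowhere_dense C).

Lemma not_shattered (f : fo) (K : nat) : exists N, forall G, C G ->
  forall a : 'I_N -> nat -> gV G, ~ forall J : {set 'I_N}, exists b : nat -> gV G,
    forall i, holds (@gE G) (mix (fun x => x < K) (a i) b) f = (i \in J).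
Proof.
have [n bf] := bounded_vars_exists f.
pose q := qrank f; pose X : pred nat := fun x => x < K.
have [s H] := tuple_quasi_wide HC ndC n (4 * 2 ^ q).
(* In a class of more than [m] tuples of one type, both a set of [n.+1] of them and its complement
   have more than [n] elements, hence each contains a tuple far from [b]. *)
pose m := n.+1 + n.+2.
have {H}[N H] := H (#|ltype n s q| * m).+1.
exists N => G CG a sh.
have [|S [J0 [cS cJ0 spr]]] := H G CG _ a; first by rewrite card_ord.
have eS := @gE_sym G.
pose ty i := @typ _ (@gE G) S n s q X (a i).
have [v Hv] := @large_fiber _ _ J0 ty _ m (max_card _) cJ0.
set F := [set l in J0 | _] in Hv.
pose I : finType := {i | i \in F}.
have cI : #|I| = #|F| by rewrite card_sig.
have [J1 cJ1] : exists J1 : {set I}, #|J1| = n.+1.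
  have /card_gt0P[J1] : 0 < #|[set B : {set I} | #|B| == n.+1]|.
    by rewrite card_draws bin_gt0 cI; apply: leq_trans (ltnW Hv); rewrite leq_addr.
  by rewrite inE => /eqP; exists J1.
pose J := [set val l | l in J1].
have [b Hb] := sh J.
pose a' (l : I) := a (val l).
have eqt l l' : @typ _ (@gE G) S n s q X (a' l) = @typ _ (@gE G) S n s q X (a' l').
  have := valP l; have := valP l'; rewrite !inE => /andP[_ /eqP E'] /andP[_ /eqP E].
  by rewrite -!/(ty _) E E'.
have spr' : spread (@gE G) S n (4 * 2 ^ q) X a'.
  move=> l l' ll' x x' xn xn' _ _; apply: spr => //.
  - by have := valP l; rewrite inE => /andP[].
  - by have := valP l'; rewrite inE => /andP[].
have spr2 : spread (@gE G) S n (2 ^ q + 2 ^ q) X a'.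
  move=> l l' ll' x x' xn xn' Xx Xx' nr; apply: (spr' l l' ll' x x') => //.
  by apply: near_le nr; lia.
have [|l1 l1J f1] := spread_far_exists eS b (L := J1) spr2; first by rewrite cJ1.
have [|l2 l2J f2] := spread_far_exists eS b (L := ~: J1) spr2.
  by have := cardsC J1; rewrite cI cJ1; rewrite /m in Hv; lia.
have loc := local_holds eS cS bf (leqnn q).
have h1 : holds (@gE G) (mix X (a' l1) b) f.
  by rewrite Hb /J; apply/imsetP; exists l1.
have := loc I X a' b _ eqt spr' l1 l2 f1 f2 h1; rewrite Hb => /(_ _)/imsetP[].
  by rewrite cI; rewrite /m in Hv; lia.
by move=> l lJ /val_inj E; move: l2J; rewrite inE E lJ.
Qed.

End NotShattered.

(** * Edges of interpreted graphs *)

Lemma holds_agree (V : finType) (e : rel V) f (P : nat -> bool) a b : fv_in P f ->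
  (forall i, P i -> a i = b i) -> holds e a f = holds e b f.
Proof.
have ext (i : nat) (P' : nat -> bool) (a' b' : nat -> V) z : (forall j, P' j -> a' j = b' j) ->
    forall j, (j == i) || P' j -> upd a' i z j = upd b' i z j.
  by move=> E j; rewrite /upd; case: eqP => //= _ /E.
elim: f P a b => [i j|i j|g IH|g IHg h IHh|g IHg h IHh|i g IH|i g IH] P a b /=.
- by move=> /andP[Pi Pj] E; rewrite !E.
- by move=> /andP[Pi Pj] E; rewrite !E.
- by move=> Pg E; rewrite (IH P a b).
- by move=> /andP[Pg Ph] E; rewrite (IHg P a b) // (IHh P a b).
- by move=> /andP[Pg Ph] E; rewrite (IHg P a b) // (IHh P a b).
- by move=> Pg E; apply: eq_existsb => z; apply: IH Pg _; apply: ext.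
- by move=> Pg E; apply: eq_forallb => z; apply: IH Pg _; apply: ext.
Qed.

Section InterpretedGraph.
Variables (S : scheme) (vS : valid_scheme S).

Lemma ivert_rep G (A : ivert S G) :
  exists2 t, holds (@gE G) (env1 t) (s0 S) & val A = iclass (S := S) (G := G) t.
Proof. by have /imsetP[t /classical_sets.set_mem T0t ->] := valP A; exists t. Qed.

Lemma iedge_rep G (A B : ivert S G) t u : val A = iclass t -> val B = iclass u ->
  iedge A B = holds (@gE G) (env2 t u) (s1 S).
Proof.
have [_ _ _ /(_ G)[[Er _] [[_ E1] _]]] := vS.
move=> eA eB; apply/existsP/idP => [[t' /andP[tA /existsP[u' /andP[uB h]]]]|h].
  by move: tA uB; rewrite eA eB !inE => tA uB; rewrite (E1 _ _ _ _ tA uB).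
exists t; rewrite eA inE Er /=; apply/existsP; exists u.
by rewrite eB inE Er h.
Qed.

Lemma iedge_sym G : symmetric (@iedge S G).
Proof.
move=> A B; have [t T0t eA] := ivert_rep A; have [u T0u eB] := ivert_rep B.
rewrite (iedge_rep eA eB) (iedge_rep eB eA).
by have [_ _ _ /(_ G)[_ [_ [H _]]]] := vS; apply: H.
Qed.

Lemma env2_mix (V : finType) K (t u : K.+1.-tuple V) x : x < 2 * K.+1 ->
  env2 t u x = mix (fun x => x < K.+1) (nth (tnth t ord0) t) (fun x => nth (tnth u ord0) u (x - K.+1)) x.
Proof.
move=> lt; rewrite /env2 /mix nth_cat size_tuple; case: ltnP => // le.
apply: set_nth_default; rewrite size_tuple; lia.
Qed.

Lemma iedge_not_shattered C : monotone_class C -> nowhere_dense C ->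
  exists N, forall G, C G -> forall (a : 'I_N -> ivert S G) (b : {set 'I_N} -> ivert S G),
    ~ forall i J, iedge (a i) (b J) = (i \in J).
Proof.
move=> HC nd; have [N HN] := not_shattered HC nd (s1 S) (sk S).+1.
exists N => G CG a b sh.
have /choice[t Ht] : forall i, exists t, val (a i) = iclass (S := S) (G := G) t.
  by move=> i; have [t _ E] := ivert_rep (a i); exists t.
apply: (HN G CG (fun i => nth (tnth (t i) ord0) (t i))) => J.
have [u _ Hu] := ivert_rep (b J).
(* The second tuple occupies the variables from [(sk S).+1] on, hence the shift. *)
exists (fun x => nth (tnth u ord0) u (x - (sk S).+1)) => i.
have [_ _ fv1 _] := vS.
rewrite -sh (iedge_rep (Ht i) Hu); apply/esym; apply: holds_agree fv1 _ => x; exact: env2_mix.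
Qed.
End InterpretedGraph.

(** * Subdivided graphs with leaves *)

Section WalkFormula.

(** The current vertex runs through variables of even index, so the target, held in variable 3, is
    never overwritten. The equality makes steps lazy: walks of at most [k] edges are captured. *)
Fixpoint walk_fo (k i : nat) : fo :=
  if k is k'.+1 then FEx i.+2 (FAnd (FOr (FEq i i.+2) (FAdj i i.+2)) (walk_fo k' i.+2))
  else FEq i 3.

(** Some neighbours of the two vertices are joined by a lazy walk. On every graph this is symmetric,
    by reversal, and the first conjunct makes it irreflexive. *)
Definition leaf_fo (p : nat) : fo :=
  FAnd (FNot (FEq 0 1)) (FEx 2 (FAnd (FAdj 0 2) (FEx 3 (FAnd (FAdj 3 1) (walk_fo p.+1 2))))).

Variables (V : finType) (e : rel V).

Fixpoint walk (k : nat) (u v : V) : bool :=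
  if k is k'.+1 then [exists z, ((u == z) || e u z) && walk k' z v] else u == v.

Lemma holds_walk_fo k i a : ~~ odd i -> holds e a (walk_fo k i) = walk k (a i) (a 3).
Proof.
elim: k i a => //= k IH i a oi; apply: eq_existsb => z.
rewrite IH /= ?negbK // /upd eqxx; have -> : (i == i.+2) = false by apply/eqP; lia.
by have -> : (3 == i.+2) = false by apply/eqP => E; case: i oi E => [|[|]].
Qed.

Lemma holds_leaf_fo p u v : holds e (env_pair u v) (leaf_fo p) =
  (u != v) && [exists a, e u a && [exists b, e b v && walk p.+1 a b]].
Proof.
rewrite /leaf_fo; cbn [holds]; congr (_ && _); apply: eq_existsb => a.
by congr (_ && _); apply: eq_existsb => b; congr (_ && _); rewrite holds_walk_fo.
Qed.

Lemma walk_rcons k u v w : walk k u v -> (v == w) || e v w -> walk k.+1 u w.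
Proof.
elim: k u => [|k IH] u.
  by move=> /eqP -> vw; apply/existsP; exists w; rewrite vw eqxx.
move=> /existsP[z /andP[uz zv]] vw; apply/existsP; exists z; rewrite uz /=; exact: IH.
Qed.

Hypothesis es : symmetric e.

Lemma walk_sym k : symmetric (walk k).
Proof.
suff imp u v : walk k u v -> walk k v u by move=> u v; apply/idP/idP; apply: imp.
elim: k u v => [|k IH] u v /=; first by rewrite eq_sym.
move=> /existsP[z /andP[uz /IH zv]]; apply: walk_rcons zv _.
by rewrite eq_sym es.
Qed.

Lemma walk_lipschitz (f : V -> nat) k u v : (forall x y, e x y -> f y <= (f x).+1) ->
  walk k u v -> f v <= f u + k.
Proof.
move=> fL; elim: k u => [|k IH] u /=; first by move=> /eqP ->; rewrite addn0.
move=> /existsP[z /andP[/orP[/eqP <-|/fL uz] /IH]]; lia.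
Qed.

End WalkFormula.

Lemma walk_fo_fv k i (P : nat -> bool) : P i -> P 3 -> fv_in P (walk_fo k i).
Proof.
elim: k i P => [|k IH] i P Pi P3 /=; first by rewrite Pi P3.
by rewrite Pi !eqxx !orbT /= IH ?eqxx // P3 orbT.
Qed.

Lemma leaf_fo_valid p : valid_basic (leaf_fo p).
Proof.
split; first by cbn [leaf_fo fv_in]; rewrite walk_fo_fv.
move=> G u v; rewrite !holds_leaf_fo eqxx; split=> //; rewrite eq_sym; congr (_ && _).
have es := @gE_sym G.
have imp x y : [exists a, gE x a && [exists b, gE b y && walk (@gE G) p.+1 a b]] ->
   [exists a, gE y a && [exists b, gE b x && walk (@gE G) p.+1 a b]].
  move=> /existsP[a /andP[xa /existsP[b /andP[bY w]]]].
  apply/existsP; exists b; rewrite es bY; apply/existsP; exists a.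
  by rewrite es xa walk_sym.
by apply/idP/idP; apply: imp.
Qed.

Section Arrows.
Variable d : nat.
Definition site : finType := ('I_d * {set 'I_d})%type.

Definition arrow (x y : site) : bool := (x.1 < y.1) && (x.1 \in y.2).

Definition arrows : finType := {a : site * site | arrow a.1 a.2}.

(* [sd_dir] orients the edges of a clique by the order of ordinals; this rank is increasing along
   arrows. *)
Definition site_rank (x : site) : nat := x.1 * #|{set 'I_d}| + enum_rank x.2.

Lemma site_rank_lt (x y : site) : x.1 < y.1 -> site_rank x < site_rank y.
Proof.
move=> lt; rewrite /site_rank; apply: (@leq_trans (x.1.+1 * #|{set 'I_d}|)).
  by rewrite mulSn addnC ltn_add2r.
by apply: leq_trans (leq_addr _ _); rewrite leq_mul2r lt orbT.
Qed.

Lemma site_rank_inj : injective site_rank.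
Proof.
move=> x y E; have [lt|lt|eq1] := ltngtP x.1 y.1.
- by have := site_rank_lt lt; rewrite E ltnn.
- by have := site_rank_lt lt; rewrite E ltnn.
move: E; rewrite /site_rank eq1 => /addnI/val_inj/enum_rank_inj E2.
by rewrite [x]surjective_pairing [y]surjective_pairing E2 (val_inj eq1).
Qed.

Lemma site_rank_bound x : site_rank x < #|site|.
Proof.
rewrite card_prod card_ord; apply: (@leq_trans (x.1.+1 * #|{set 'I_d}|)).
  by rewrite /site_rank mulSn addnC ltn_add2r.
by rewrite leq_mul2r ltn_ord orbT.
Qed.

Section Leafy.
Variables (p M : nat).

(* Branch vertices, subdivision vertices and leaves. *)
Definition leafy_vertex : finType := (site + arrows * 'I_p + site * 'I_M)%type.

Definition leafy_dir (u v : leafy_vertex) : bool :=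
  match u, v with
  | inl (inl x), inl (inl y) => (p == 0) && arrow x y
  | inl (inl x), inl (inr (a, l)) =>
      ((x == (val a).1) && (l == 0 :> nat)) || ((x == (val a).2) && (l == p.-1 :> nat))
  | inl (inr (a, l)), inl (inr (a', l')) => (a == a') && (l' == l.+1 :> nat)
  | inl (inl x), inr (y, _) => x == y
  | _, _ => false
  end.

Definition leafy_adj : rel leafy_vertex := fun u v => leafy_dir u v || leafy_dir v u.

Lemma leafy_adj_sym : symmetric leafy_adj.
Proof. by move=> u v; rewrite /leafy_adj orbC. Qed.

Lemma leafy_adj_irr : irreflexive leafy_adj.
Proof.
move=> u; rewrite /leafy_adj orbb; case: u => [[x|[a l]]|[y i]] //=.
  by rewrite /arrow ltnn andbF.
by rewrite eqxx /=; apply/negbTE; rewrite neq_ltn ltnSn.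
Qed.

Definition leafy_graph : graph := Graph leafy_adj_sym leafy_adj_irr.

Definition leaf (x : site) (i : 'I_M) : leafy_vertex := inr (x, i).
Definition branch (x : site) : leafy_vertex := inl (inl x).

(** Each leaf gets a fresh clique vertex. For [p] = 0 the leaf is that vertex; for positive [p] it
    is the first subdivision vertex on the edge leading there. *)
Lemma leafy_embeds : exists N (f : leafy_vertex -> sdV N p), injective f /\
  forall u v, leafy_adj u v -> sd_adj (f u) (f v).
Proof.
pose L : finType := (site * 'I_M)%type.
(* The fresh vertices are numbered after all sites, so these edges are oriented away from the site
   and their subdivision vertex 0 is adjacent to it. *)
pose N := #|site| + #|L|.
have ltb x : site_rank x < N by apply: leq_trans (site_rank_bound x) (leq_addr _ _).
have ltl (c : L) : #|site| + enum_rank c < N by rewrite ltn_add2l.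
pose fb x : 'I_N := Ordinal (ltb x).
pose fl c : 'I_N := Ordinal (ltl c).
have fbI : injective fb by move=> x y /(congr1 val)/site_rank_inj.
have flI : injective fl by move=> c c' /(congr1 val)/addnI/val_inj/enum_rank_inj.
have blt x c : fb x < fl c by apply: leq_trans (site_rank_bound x) (leq_addr _ _).
have fbl x c : fb x != fl c by rewrite neq_ltn blt.
have oa (a : arrows) : fb (val a).1 < fb (val a).2.
  by apply: site_rank_lt; have /andP[] := valP a.
have ol (c : L) : fb c.1 < fl c := blt _ _.
pose ea (a : arrows) : sdedge N := exist (fun e : 'I_N * 'I_N => e.1 < e.2) (fb (val a).1, fb (val a).2) (oa a).
pose el (c : L) : sdedge N := exist (fun e : 'I_N * 'I_N => e.1 < e.2) (fb c.1, fl c) (ol c).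
have eaI : injective ea.
  by move=> a a' /(congr1 val) /= [/site_rank_inj E1 /site_rank_inj E2]; apply: val_inj;
     rewrite [val a]surjective_pairing [val a']surjective_pairing E1 E2.
have elI : injective el by move=> c c' /(congr1 val) /= /(congr1 snd) /= /flI.
have eal a c : ea a != el c.
  by apply/eqP => /(congr1 val) /= /(congr1 snd) /= E; have := fbl (val a).2 c; rewrite E eqxx.
have inlI (i j : 'I_N) : inl i = inl j :> sdV N p -> i = j by case.
have inrI (c c' : sdedge N * 'I_p) : inr c = inr c' :> sdV N p -> c = c' by case.
exists N; case: (posnP p) => [p0|p0].
  have no (l : 'I_p) : False by have := ltn_ord l; rewrite {2}p0.
  exists (fun u => match u with inl (inl x) => inl (fb x) | inl (inr (a, l)) => inr (ea a, l)
                  | inr c => inl (fl c) end).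
  split.
    move=> [[x|[a l]]|c] [[x'|[a' l']]|c'] //; try by case: (no l).
    - by move=> /inlI/fbI ->.
    - by move=> /inlI/eqP; rewrite (negbTE (fbl _ _)).
    - by move=> /inlI/eqP; rewrite eq_sym (negbTE (fbl _ _)).
    - by move=> /inlI/flI ->.
  suff dir u v : leafy_dir u v -> sd_dir (p := p) (N := N)
     (match u with inl (inl x) => inl (fb x) | inl (inr (a, l)) => inr (ea a, l)
                  | inr c => inl (fl c) end)
     (match v with inl (inl x) => inl (fb x) | inl (inr (a, l)) => inr (ea a, l)
                  | inr c => inl (fl c) end).
    by move=> u v /orP[/dir|/dir] H; rewrite /sd_adj H ?orbT.
  case: u v => [[x|[a l]]|c] [[x'|[a' l']]|c'] //=; try by [case: (no l) | case: (no l')].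
  - by rewrite p0 /= => /andP[lt _]; apply: site_rank_lt.
  - by case: c' => y i /eqP ->; rewrite p0 /=; apply: blt.
pose o0 : 'I_p := Ordinal p0.
exists (fun u => match u with inl (inl x) => inl (fb x) | inl (inr (a, l)) => inr (ea a, l)
                  | inr c => inr (el c, o0) end).
split.
  move=> [[x|[a l]]|c] [[x'|[a' l']]|c'] //.
  - by move=> /inlI/fbI ->.
  - by move=> /inrI/eqP; rewrite xpair_eqE => /andP[/eqP/eaI -> /eqP ->].
  - by move=> /inrI/eqP; rewrite xpair_eqE (negbTE (eal _ _)).
  - by move=> /inrI/eqP; rewrite xpair_eqE eq_sym (negbTE (eal _ _)).
  - by move=> /inrI/eqP; rewrite xpair_eqE => /andP[/eqP/elI ->].
suff dir u v : leafy_dir u v -> sd_dir (p := p) (N := N)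
   (match u with inl (inl x) => inl (fb x) | inl (inr (a, l)) => inr (ea a, l)
                  | inr c => inr (el c, o0) end)
   (match v with inl (inl x) => inl (fb x) | inl (inr (a, l)) => inr (ea a, l)
                  | inr c => inr (el c, o0) end).
  by move=> u v /orP[/dir|/dir] H; rewrite /sd_adj H ?orbT.
case: u v => [[x|[a l]]|c] [[x'|[a' l']]|c'] //=.
- by move=> /andP[-> xx]; apply: site_rank_lt; case/andP: xx.
- by move=> /orP[] /andP[/eqP -> ->]; rewrite eqxx ?orbT.
- by case: c' => y i /eqP ->; rewrite eqxx.
- by move=> /andP[/eqP -> ->]; rewrite eqxx.
Qed.

Lemma leaf_neighbour x i u : leafy_adj (leaf x i) u = (u == branch x).
Proof. by case: u => [[y|[a l]]|[y j]]. Qed.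

Lemma walk_along_arrow x y : arrow x y -> walk leafy_adj p.+1 (branch x) (branch y).
Proof.
move=> xy; case: (posnP p) => [p0|p0].
  apply/existsP; exists (branch y); apply/andP; split; last by rewrite p0 /=.
  by rewrite /leafy_adj /= xy p0 eqxx ?orbT.
pose a : arrows := exist (fun a : site * site => arrow a.1 a.2) (x, y) xy.
have step l (lp : l < p) : walk leafy_adj l.+1 (branch x) (inl (inr (a, Ordinal lp))).
  elim: l lp => [|l IH] lp.
    apply/existsP; exists (inl (inr (a, Ordinal lp))); apply/andP; split; last exact: eqxx.
    by rewrite /leafy_adj /= !eqxx ?orbT.
  apply: (walk_rcons (IH (ltnW lp))).
  by rewrite /leafy_adj /= !eqxx ?orbT.
have lp : p.-1 < p by rewrite prednK.
have := step _ lp; rewrite prednK // => w; apply: walk_rcons w _.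
by rewrite /leafy_adj /= !eqxx ?orbT.
Qed.

Lemma walk_branches (x y : site) : x.1 != y.1 ->
  walk leafy_adj p.+1 (branch x) (branch y) = arrow x y || arrow y x.
Proof.
move=> ne; apply/idP/orP => [w|[xy|yx]]; last 2 first.
- exact: walk_along_arrow.
- by rewrite (walk_sym leafy_adj_sym); apply: walk_along_arrow.
apply/orP/negPn/negP => nxy.
(* The distance to [branch x], truncated at [p + 2]. *)
pose f (u : leafy_vertex) : nat := match u with
  | inl (inl z) => if z == x then 0 else if arrow x z || arrow z x then p.+1 else p.+2
  | inl (inr (a, l)) => if (val a).1 == x then l.+1 else if (val a).2 == x then p - l else p.+2
  | inr (z, _) => if z == x then 1 else p.+2 end.
have fL u v : leafy_adj u v -> f v <= (f u).+1.
  suff dir u1 v1 : leafy_dir u1 v1 -> f v1 <= (f u1).+1 /\ f u1 <= (f v1).+1.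
    by move=> /orP[/dir[]|/dir[]].
  case: u1 v1 => [[z|[[[z1 z2] z12] l]]|[z i]] [[z'|[[[a1 a2] a12] l']]|[z' i']] //=.
  - move=> /andP[/eqP p0 zz']; rewrite p0.
    have [zx|zx] := eqVneq z x; have [zx'|zx'] := eqVneq z' x => //.
    + by subst z; rewrite zz'.
    + by subst z'; rewrite zz' orbT.
    + by case: (arrow x z || _); case: (arrow x z' || _).
  - have lp := ltn_ord l'; have a1x : a1 == x -> a2 == x = false.
      move=> /eqP E; apply/eqP => E2; move: a12; rewrite /= E E2 /arrow ltnn //.
    move=> /orP[] /andP[/eqP -> /eqP ->] /=.
      have [E|E] := eqVneq a1 x => //; have [E2|E2] := eqVneq a2 x.
        by rewrite -E2 (a12 : arrow a1 a2) orbT subn0; lia.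
      by case: ifP => _; lia.
    have [E|E] := eqVneq a1 x.
      rewrite a1x ?E //; rewrite -E (a12 : arrow a1 a2) /=; lia.
    have [E2|E2] := eqVneq a2 x; first by lia.
    by case: ifP => _; lia.
  - by move=> /eqP ->; do ?[case: ifP => _]; lia.
  - move=> /andP[/eqP[-> ->] /eqP ->]; have lp := ltn_ord l.
    by do ?[case: ifP => _]; lia.
have := walk_lipschitz fL w; rewrite /f /= eqxx add0n.
rewrite (negbTE nxy); case: eqP => [E|_]; last by rewrite ltnn.
by rewrite E eqxx in ne.
Qed.

Lemma leaf_fo_leaves (x y : site) i j : x.1 != y.1 ->
  holds leafy_adj (env_pair (leaf x i) (leaf y j)) (leaf_fo p) = arrow x y || arrow y x.
Proof.
move=> ne; rewrite holds_leaf_fo -walk_branches //.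
have -> : leaf x i != leaf y j by apply: contraNneq ne => -[->].
apply/existsP/idP => [[a /andP[+ /existsP[b /andP[+ w]]]]|w].
  rewrite leaf_neighbour [leafy_adj _ (leaf y j)]leafy_adj_sym leaf_neighbour.
  by move=> /eqP Ea /eqP Eb; move: w; rewrite Ea Eb.
exists (branch x); rewrite leaf_neighbour eqxx; apply/existsP; exists (branch y).
by rewrite [leafy_adj _ (leaf y j)]leafy_adj_sym leaf_neighbour eqxx.
Qed.

Lemma card_leafy_vertex : #|site| * M <= #|leafy_vertex| <= #|site| + #|site| * #|site| * p + #|site| * M.
Proof.
have c1 : #|{: arrows * 'I_p}| = #|arrows| * p by rewrite card_prod card_ord.
have c2 : #|{: site * 'I_M}| = #|site| * M by rewrite card_prod card_ord.
rewrite !card_sum c1 c2 leq_addl leq_add2r leq_add2l leq_mul2r.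
by rewrite card_sig -(card_prod site site) max_card orbT.
Qed.

End Leafy.
End Arrows.

(** Serves to show that the number of edges increasing for [r] does not depend on [r]: [edge_count]
    orients by the enumeration, compatibility by the first coordinates of the sites. *)
Lemma card_oriented (F : graph) (r : gV F -> nat) : injective r ->
  2 * #|[set q : gV F * gV F | gE q.1 q.2 && (r q.1 < r q.2)]| = #|[set q : gV F * gV F | gE q.1 q.2]|.
Proof.
move=> rI; set A := [set q | _ && _].
pose sw (q : gV F * gV F) := (q.2, q.1).
have swI : injective sw by move=> [a b] [a' b'] [-> ->].
rewrite mul2n -addnn -{2}(card_imset A swI) -cardsUI.
rewrite [A :&: _](_ : _ = set0) ?cards0 ?addn0.
  apply: eq_card => -[u v]; rewrite !inE /=; apply/orP/idP.
    by case=> [/andP[]//|/imsetP[[a b]]]; rewrite inE => /andP[/= ab _] [-> ->]; rewrite gE_sym.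
  move=> uv; have [lt|lt|E] := ltngtP (r u) (r v); first by left; rewrite uv.
    by right; apply/imsetP; exists (v, u) => //; rewrite inE /= gE_sym uv.
  by move: uv; rewrite (rI _ _ E) gE_irr.
apply/setP => -[u v]; rewrite !inE /=; apply/negP => /andP[/andP[_ lt]] /imsetP[[a b]].
by rewrite inE => /andP[_ /= lt'] [E1 E2]; move: lt lt'; rewrite E1 E2; lia.
Qed.

Lemma card_supersets d (K : {set 'I_d}) : #|[set X : {set 'I_d} | K \subset X]| * 2 ^ #|K| = 2 ^ d.
Proof.
have -> : [set X : {set 'I_d} | K \subset X] = [set ~: Y | Y in powerset (~: K)].
  apply/setP => X; rewrite inE; apply/idP/imsetP => [KX|[Y]].
    by exists (~: X); rewrite ?setCK // inE setCS.
  by rewrite inE => YK ->; rewrite -setCS setCK.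
rewrite card_imset; last exact: setC_inj.
by rewrite card_powerset -expnD addnC cardsC card_ord.
Qed.

(** * Counting homomorphisms into the leaves *)

Section LeafHoms.
Variables (F : graph) (d p M : nat).
Notation n := #|gV F|.

Definition edge_count : nat := #|[set q : gV F * gV F | gE q.1 q.2 && (enum_rank q.1 < enum_rank q.2)]|.

Definition compatible (i : {ffun gV F -> 'I_d}) (J : {ffun gV F -> {set 'I_d}}) : bool :=
  [forall u, forall v, gE u v && (i u < i v) ==> (i u \in J v)].

(** For fixed [i] the conditions bear on each [J v] separately: it must contain the set [K v] of
    indices of the earlier neighbours of [v], which a fraction [2 ^ - #|K v|] of all subsets does.
    The sizes of the [K v] add up to the number of edges. *)
Lemma card_compatible (i : {ffun gV F -> 'I_d}) : injective i ->
  #|[set J | compatible i J]| * 2 ^ edge_count = (2 ^ d) ^ n.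
Proof.
move=> iI; pose K v : {set 'I_d} := [set i u | u in [set u | gE u v && (i u < i v)]].
have -> : #|[set J | compatible i J]| = \prod_v #|[set X : {set 'I_d} | K v \subset X]|.
  transitivity (\prod_v #|[pred X : {set 'I_d} | K v \subset X]|); last first.
    by apply: eq_bigr => v _; rewrite cardsE.
  rewrite -big_enum /= -(big_map _ xpredT id) -foldrE.
  rewrite -(@card_family _ (fun=> {set 'I_d}) (fun v => [pred X : {set 'I_d} | K v \subset X])).
  rewrite cardsE; apply: eq_card => J; rewrite [LHS]inE; apply/forallP/familyP => [H v|H u].
    rewrite !inE; apply/fintype.subsetP => _ /imsetP[u + ->]; rewrite inE.
    by have /forallP/(_ v)/implyP := H u; apply.
  apply/forallP => v; apply/implyP => uv; have := H v; rewrite !inE => /fintype.subsetP; apply.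
  by apply/imsetP; exists u; rewrite ?inE.
have -> : edge_count = \sum_v #|K v|.
  have valI : injective (fun v => i v : nat) by move=> u v /val_inj/iI.
  have rkI : injective (fun v : gV F => enum_rank v : nat) by move=> u v /val_inj/enum_rank_inj.
  have -> : edge_count = #|[set q : gV F * gV F | gE q.1 q.2 && (i q.1 < i q.2)]|.
    have := card_oriented valI; rewrite -(card_oriented rkI) => /eqP.
    by rewrite eqn_pmul2l // => /eqP ->.
  rewrite -sum1_card (eq_bigl (fun q => gE q.1 q.2 && (i q.1 < i q.2))); last by move=> q; rewrite inE.
  rewrite -(pair_big_dep xpredT (fun u v => gE u v && (i u < i v)) (fun _ _ => 1)) /=.
  rewrite (exchange_big_dep xpredT) //=; apply: eq_bigr => v _.
  by rewrite (card_imset _ iI) -sum1_card; apply: eq_bigl => u; rewrite inE.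
rewrite expn_sum -big_split /=; under eq_bigr do rewrite card_supersets.
by rewrite prod_nat_const.
Qed.

Notation triple := ({ffun gV F -> 'I_d} * {ffun gV F -> {set 'I_d}} * {ffun gV F -> 'I_M})%type.
Notation vertex := (leafy_vertex d p M).

Definition leaf_map (t : triple) : {ffun gV F -> vertex} :=
  [ffun u => leaf p (t.1.1 u, t.1.2 u) (t.2 u)].

Lemma leaf_map_inj : injective leaf_map.
Proof.
move=> [[i J] m] [[i' J'] m'] /ffunP E.
have H u : (i u, J u, m u) = (i' u, J' u, m' u) by have := E u; rewrite !ffunE => -[-> -> ->].
by congr (_, _, _); apply/ffunP => u; case: (H u).
Qed.

Definition leaf_rel (u v : vertex) := holds (@leafy_adj d p M) (env_pair u v) (leaf_fo p).

Definition is_hom (f : {ffun gV F -> vertex}) : bool :=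
  [forall u, forall v, gE u v ==> leaf_rel (f u) (f v)].

Lemma is_hom_leaf_map (t : triple) : injective t.1.1 ->
  is_hom (leaf_map t) = compatible t.1.1 t.1.2.
Proof.
case: t => [[i J] m] /= iI.
have E u v : gE u v -> leaf_rel (leaf_map (i, J, m) u) (leaf_map (i, J, m) v) =
    arrow (i u, J u) (i v, J v) || arrow (i v, J v) (i u, J u).
  move=> uv; rewrite /leaf_rel !ffunE leaf_fo_leaves //=.
  by rewrite (inj_eq iI); apply: contraTneq uv => ->; rewrite gE_irr.
apply/forallP/forallP => H u; apply/forallP => v; apply/implyP.
  move=> /andP[uv lt]; have /forallP/(_ v)/implyP/(_ uv) := H u; rewrite E // /arrow /= lt /=.
  by rewrite ltnNge (ltnW lt) /= orbF.
move=> uv; rewrite E // /arrow /=; have [lt|lt|eq1] := ltngtP (i u) (i v).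
- by have /forallP/(_ v)/implyP := H u; rewrite uv lt /= => ->.
- by have /forallP/(_ u)/implyP := H v; rewrite gE_sym uv lt /= => ->.
- by move: uv; rewrite (iI _ _ (val_inj eq1)) gE_irr.
Qed.

(* Almost all maps to vertices are maps to leaves of this kind, and for them being a homomorphism
   means that [edge_count] independent events of probability 1/2 hold. *)
Definition injective_triples : {set triple} := [set t : triple | injectiveb t.1.1].
Definition compatible_triples : {set triple} := [set t : triple in injective_triples | compatible t.1.1 t.1.2].

Lemma card_injective_triples : #|injective_triples| = d ^_ n * (2 ^ d) ^ n * M ^ n.
Proof.
have -> : injective_triples = setX (setX [set i : {ffun gV F -> 'I_d} | injectiveb i] setT) setT.
  by apply/setP => -[[i J] m]; rewrite !inE /= !andbT.
by rewrite !cardsX !cardsT card_inj_ffuns !card_ffun card_subsets !card_ord.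
Qed.

Lemma card_compatible_triples : #|compatible_triples| * 2 ^ edge_count = #|injective_triples|.
Proof.
have fib (A : {set triple}) : #|A| = \sum_i \sum_m #|[set J | (i, J, m) \in A]|.
  rewrite -sum1_card pair_big /=.
  rewrite (partition_big (fun t : triple => (t.1.1, t.2)) xpredT) //=; apply: eq_bigr => -[i m] _.
  have fI : injective (fun J => (i, J, m) : triple) by move=> J J' [].
  rewrite sum1_card -(card_imset [set J | (i, J, m) \in A] fI).
  apply: eq_card => -[[i' J] m']; rewrite -topredE /=.
  apply/andP/imsetP => [[tA /eqP[Ei Em]]|[J']].
    by subst; exists J; rewrite ?inE.
  by rewrite inE => JA [-> -> ->]; rewrite eqxx.
rewrite !fib big_distrl /=; apply: eq_bigr => i _; rewrite big_distrl /=; apply: eq_bigr => m _.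
case: (boolP (injectiveb i)) => iI; last first.
  have E0 (A : {set triple}) : A \subset injective_triples -> [set J | (i, J, m) \in A] = set0.
    move=> /fintype.subsetP sA; apply/setP => J; rewrite !inE; apply/negP => /sA.
    by rewrite inE /= (negbTE iI).
  rewrite (E0 injective_triples) // (E0 compatible_triples) ?cards0 //.
  by apply/fintype.subsetP => t; rewrite inE => /andP[].
transitivity (#|[set J | compatible i J]| * 2 ^ edge_count).
  by congr (_ * _); apply: eq_card => J; rewrite !inE /= iI.
rewrite card_compatible; last exact/injectiveP.
have -> : [set J | (i, J, m) \in injective_triples] = setT by apply/setP => J; rewrite !inE.
by rewrite cardsT card_ffun card_subsets card_ord.
Qed.

Lemma compatible_leq_hom : #|compatible_triples| <= #|is_hom|.
Proof.
rewrite -(card_imset _ leaf_map_inj); apply: subset_leq_card; apply/fintype.subsetP => f.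
move=> /imsetP[t]; rewrite !inE => /andP[/injectiveP tI tc] ->.
by rewrite -topredE /= is_hom_leaf_map.
Qed.

(** A homomorphism either comes from a triple with injective [i], and is then compatible, or is one
    of the remaining maps. The additive form avoids truncated subtraction. *)
Lemma hom_leq_compatible :
  #|is_hom| + #|injective_triples| <= #|compatible_triples| + #|vertex| ^ n.
Proof.
rewrite -card_ffun -(card_imset injective_triples leaf_map_inj) -(card_imset _ leaf_map_inj).
set A := leaf_map @: injective_triples; set B := leaf_map @: _.
pose H := [set f | is_hom f]; rewrite -[#|is_hom|](cardsE is_hom) -/H.
rewrite -cardsUI addnC leq_add ?max_card //; apply: subset_leq_card; apply/fintype.subsetP => f.
rewrite inE => /andP[fH /imsetP[t tI E]]; apply/imsetP; exists t => //.
rewrite inE tI /=; move: tI fH; rewrite !inE E => /injectiveP tI.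
by rewrite is_hom_leaf_map.
Qed.
End LeafHoms.

From mathcomp Require Import ring lra.
From mathcomp Require Import all_classical all_reals all_analysis measurable_realfun.
Import Order.TTheory GRing.Theory Num.Theory.
Import numFieldNormedType.Exports.
Local Open Scope classical_set_scope.
Local Open Scope ring_scope.

(** * Iterated integrals over the unit interval *)

Section UnitIntegral.
Variable R : realType.
Notation mu := (@lebesgue_measure R).
Notation I01 := ([set` `[0%R, 1%R]] : set R).
Implicit Types (f g : R -> R).

Definition bmeas f := measurable_fun setT f /\ exists M, forall s, `|f s| <= M.

Definition int1 f : R := Rintegral mu I01 f.

Lemma bmeas_integrable f : bmeas f -> mu.-integrable I01 (EFin \o f).
Proof.
move=> [mf [M bM]]; apply: measurable_bounded_integrable => //.
- by rewrite /= lebesgue_measure_itv /= lte01 oppr0 adde0 ltry.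
- exact: measurable_funTS.
- exists M; split; first exact: num_real.
  by move=> x Mx s _; apply: le_trans (bM s) (ltW Mx).
Qed.

Lemma ae_imply (P Q : R -> Prop) : (forall s, P s -> Q s) ->
  {ae mu, forall s, P s} -> {ae mu, forall s, Q s}.
Proof. by move=> PQ H; exact: (@filterS _ _ (ae_filter_ringOfSetsType mu) _ _ PQ H). Qed.

Lemma EFin_int1 f : bmeas f -> (int1 f)%:E = (\int[mu]_(s in I01) (f s)%:E)%E.
Proof.
move=> bf; rewrite /int1 /Rintegral fineK //.
exact: (integrable_fin_num _ (bmeas_integrable bf)).
Qed.

Lemma int1_cst (c : R) : int1 (fun=> c) = c.
Proof. by rewrite /int1 Rintegral_cst //= lebesgue_measure_itv /= lte01 oppr0 adde0 mulr1. Qed.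

Lemma eq_int1 f g : (forall s, 0 <= s <= 1 -> f s = g s) -> int1 f = int1 g.
Proof.
move=> E; apply: eq_Rintegral => s; rewrite inE /= in_itv /=; exact: E.
Qed.

Lemma int1_ge0 f : (forall s, 0 <= f s) -> 0 <= int1 f.
Proof. by move=> f0; apply: Rintegral_ge0. Qed.

Lemma int1_le f g : bmeas f -> bmeas g -> (forall s, f s <= g s) -> int1 f <= int1 g.
Proof. by move=> bf bg le; apply: le_Rintegral => //; exact: bmeas_integrable. Qed.

Lemma int1D f g : bmeas f -> bmeas g -> int1 (fun s => f s + g s) = int1 f + int1 g.
Proof. by move=> bf bg; apply: RintegralD => //; exact: bmeas_integrable. Qed.

Lemma int1Z c f : bmeas f -> int1 (fun s => c * f s) = c * int1 f.
Proof. by move=> bf; apply: RintegralZl => //; exact: bmeas_integrable. Qed.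

Lemma int1_eq0 f : bmeas f -> (forall s, 0 <= f s) -> int1 f = 0 ->
  {ae mu, forall s, I01 s -> f s = 0}.
Proof.
move=> bf f0 H.
have mf : measurable_fun I01 (EFin \o f).
  by apply/measurable_EFinP; apply: measurable_funTS; case: bf.
have H0 : (\int[mu]_(s in I01) `|(EFin \o f) s| = 0)%E.
  under eq_integral => s _ do rewrite gee0_abs ?lee_fin //.
  by rewrite -EFin_int1 // H.
have /(ae_eq_integral_abs mu (measurable_itv _) mf) := H0.
by apply: ae_imply => s H' Is; have [] := H' Is.
Qed.

Lemma ae_int1_eq0 f : bmeas f -> {ae mu, forall s, I01 s -> f s = 0} -> int1 f = 0.
Proof.
move=> bf H; apply: EFin_inj; rewrite EFin_int1 //.
transitivity (\int[mu]_(s in I01) (cst 0%E s : \bar R))%E; last by rewrite integral0.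
apply: ae_eq_integral => //.
- by apply/measurable_EFinP; apply: measurable_funTS; case: bf.
- by apply: ae_imply H => s H' Is; rewrite H'.
Qed.

(* Measurability is required along every measurable family of points, so that no measurable
   structure on [nat -> R] is needed. *)
Definition admissible (F : (nat -> R) -> R) : Prop :=
  (exists M, forall x, `|F x| <= M) /\
  forall (d : measure_display) (T : measurableType d) (g : T -> nat -> R),
    (forall i, measurable_fun setT (fun t => g t i)) -> measurable_fun setT (fun t => F (g t)).

Lemma measurable_upd (d : measure_display) (T : measurableType d) (g : T -> nat -> R) v :
  (forall i, measurable_fun setT (fun t => g t i)) ->
  forall i, measurable_fun setT (fun p : T * R => upd (g p.1) v p.2 i).
Proof.
move=> mg i; rewrite /upd; case: eqP => _; first exact: measurable_snd.
exact: (measurableT_comp (mg i) measurable_fst).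
Qed.

Lemma admissible_upd F x v : admissible F -> bmeas (fun s => F (upd x v s)).
Proof.
move=> [[M bM] mF]; split; last by exists M.
apply: mF => i; rewrite /upd; case: eqP => _; first exact: measurable_id.
exact: measurable_cst.
Qed.

Lemma admissible_cst c : admissible (fun=> c).
Proof. by split=> [|d T g _]; [exists `|c| | exact: measurable_cst]. Qed.

Lemma admissibleD F G : admissible F -> admissible G -> admissible (fun x => F x + G x).
Proof.
move=> [[M bM] mF] [[N bN] mG]; split=> [|d T g mg].
  by exists (M + N) => x; apply: le_trans (ler_normD _ _) _; apply: lerD.
by apply: measurable_funD; [exact: mF | exact: mG].
Qed.

Lemma admissibleM F G : admissible F -> admissible G -> admissible (fun x => F x * G x).
Proof.
move=> [[M bM] mF] [[N bN] mG]; split=> [|d T g mg].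
  by exists (M * N) => x; rewrite normrM; apply: ler_pM.
by apply: measurable_funM; [exact: mF | exact: mG].
Qed.

Lemma admissible_sum (I : Type) (r : seq I) (P : pred I) (F : I -> (nat -> R) -> R) :
  (forall i, admissible (F i)) -> admissible (fun x => \sum_(i <- r | P i) F i x).
Proof.
move=> aF; elim: r => [|i r IH].
  by under eq_fun do rewrite big_nil; exact: admissible_cst.
under eq_fun do rewrite big_cons; case: (P i) => //.
by apply: admissibleD.
Qed.

Lemma admissible_prod (I : Type) (r : seq I) (P : pred I) (F : I -> (nat -> R) -> R) :
  (forall i, admissible (F i)) -> admissible (fun x => \prod_(i <- r | P i) F i x).
Proof.
move=> aF; elim: r => [|i r IH].
  by under eq_fun do rewrite big_nil; exact: admissible_cst.
under eq_fun do rewrite big_cons; case: (P i) => //.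
by apply: admissibleM.
Qed.

Lemma norm_int1 f M : bmeas f -> (forall s, `|f s| <= M) -> `|int1 f| <= M.
Proof.
move=> bf bM; apply: le_trans (le_normr_Rintegral _ (bmeas_integrable bf)) _ => //.
have ba : bmeas (fun s => `|f s|).
  case: bf => mf _; split; first exact: measurableT_comp.
  by exists M => s; rewrite normr_id.
apply: le_trans (int1_le ba _ bM) _; last by rewrite int1_cst.
by split; [exact: measurable_cst | exists `|M|].
Qed.

Lemma restrict_EFin f s : ((EFin \o f) \_ I01) s = (f s * (s \in I01)%:R)%:E.
Proof. by rewrite patchE; case: ifP => _ /=; rewrite ?mulr1 ?mulr0. Qed.

Lemma measurable_in_I01 : measurable_fun setT (fun s : R => (s \in I01)%:R : R).
Proof.
have -> : (fun s : R => (s \in I01)%:R : R) = \1_I01 by apply: funext => s; rewrite indicE.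
exact: measurable_indic.
Qed.

(** The measurability part of Tonelli's theorem concerns nonnegative functions, so [h] is raised by
    its bound [M], and [M] is subtracted from the integral. *)
Lemma measurable_int1 (d : measure_display) (T : measurableType d) (h : T * R -> R) :
  measurable_fun setT h -> (exists M, forall p, `|h p| <= M) ->
  measurable_fun setT (fun t => int1 (fun s => h (t, s))).
Proof.
move=> mh [M bM].
have bh t : bmeas (fun s => h (t, s)).
  by split; [exact: measurable_fun_pair2 | exists M].
have bc c : bmeas (fun=> c : R) by split; [exact: measurable_cst | exists `|c|].
have bhM t : bmeas (fun s => h (t, s) + M).
  split; first by apply: measurable_funD; [exact: measurable_fun_pair2 | exact: measurable_cst].
  by exists (M + `|M|) => s; apply: le_trans (ler_normD _ _) _; apply: lerD.
pose k (p : T * R) := ((h p + M) * (p.2 \in I01)%:R)%:E : \bar R.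
have hM0 p : 0 <= h p + M.
  by have := bM p; rewrite ler_norml => /andP[]; rewrite -lerBlDr sub0r => ? _; lra.
have mk : measurable_fun setT k.
  apply/measurable_EFinP; apply: measurable_funM.
    by apply: measurable_funD => //; exact: measurable_cst.
  exact: (measurableT_comp measurable_in_I01 measurable_snd).
have k0 p : (0 <= k p)%E by rewrite lee_fin mulr_ge0.
have mF := measurable_fun_fubini_tonelli_F (m2 := mu) k mk k0.
have E t : int1 (fun s => h (t, s)) = fine (fubini_F mu k t) - M.
  rewrite /fubini_F; have -> : (\int[mu]_y k (t, y))%E = (int1 (fun s => h (t, s) + M))%:E.
    rewrite EFin_int1 // [RHS]integral_mkcond; congr integral.
    by apply: funext => s; rewrite (restrict_EFin (fun s => h (t, s) + M)).
  by rewrite /= int1D // int1_cst addrK.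
under eq_fun do rewrite E.
apply: measurable_funB; last exact: measurable_cst.
exact: (measurableT_comp (fine_measurable measurableT) mF).
Qed.

Lemma admissible_int1 F v : admissible F -> admissible (fun x => int1 (fun s => F (upd x v s))).
Proof.
move=> aF; have [[M bM] mF] := aF; split.
  by exists M => x; apply: norm_int1 => //; apply: admissible_upd.
move=> d T g mg; apply: (@measurable_int1 _ _ (fun p => F (upd (g p.1) v p.2))); last by exists M.
by apply: mF; apply: measurable_upd.
Qed.


(** Cutting off by indicators turns integrals over the unit interval into integrals over the line,
    where Tonelli's theorem applies to the full product measure. *)
Definition cut_square (h : R * R -> R) (p : R * R) : \bar R :=
  (h p * (p.1 \in I01)%:R * (p.2 \in I01)%:R)%:E.

Lemma cut_square_ge0 h p : (forall p, 0 <= h p) -> (0 <= cut_square h p)%E.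
Proof. by move=> h0; rewrite lee_fin !mulr_ge0. Qed.

Lemma measurable_cut_square h : measurable_fun setT h -> measurable_fun setT (cut_square h).
Proof.
move=> mh; apply/measurable_EFinP; apply: measurable_funM.
  by apply: measurable_funM => //; exact: (measurableT_comp measurable_in_I01 measurable_fst).
exact: (measurableT_comp measurable_in_I01 measurable_snd).
Qed.

Lemma EFin_int1_int1 (h : R * R -> R) : measurable_fun setT h -> (exists M, forall p, `|h p| <= M) ->
  (int1 (fun s => int1 (fun t => h (s, t))))%:E =
  (\int[mu]_s \int[mu]_t cut_square h (s, t))%E.
Proof.
move=> mh [M bM].
have bh s : bmeas (fun t => h (s, t)) by split; [exact: measurable_fun_pair2 | exists M].
have bi : bmeas (fun s => int1 (fun t => h (s, t))).
  by split; [apply: measurable_int1 => //; exists M | exists M => s; apply: norm_int1].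
rewrite EFin_int1 // integral_mkcond; congr integral; apply: funext => s.
rewrite (restrict_EFin (fun s => int1 (fun t => h (s, t)))) mulrC -int1Z //.
have bc : bmeas (fun t => (s \in I01)%:R * h (s, t)).
  split; first by apply: measurable_funM; [exact: measurable_cst | case: (bh s)].
  exists M => t; rewrite normrM; apply: le_trans (_ : 1 * `|h (s, t)| <= _); last by rewrite mul1r.
  by rewrite ler_wpM2r //; case: (s \in _); rewrite ?normr1 ?normr0.
rewrite EFin_int1 // integral_mkcond; congr integral; apply: funext => t.
by rewrite (restrict_EFin (fun t => _ * h (s, t))) /cut_square /= (mulrC (h _)).
Qed.

Lemma int1_swap (h : R * R -> R) : measurable_fun setT h -> (exists M, forall p, `|h p| <= M) ->
  (forall p, 0 <= h p) ->
  int1 (fun s => int1 (fun t => h (s, t))) = int1 (fun t => int1 (fun s => h (s, t))).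
Proof.
move=> mh [M bM] h0; apply: EFin_inj; rewrite EFin_int1_int1 //; last by exists M.
rewrite (@EFin_int1_int1 (fun p => h (p.2, p.1))); last 2 first.
- by apply: (measurableT_comp mh); apply: measurable_fun_pair.
- by exists M.
rewrite (fubini_tonelli (m1 := mu) (m2 := mu) (cut_square h)); last 2 first.
- exact: measurable_cut_square.
- by move=> p; apply: cut_square_ge0.
congr integral; apply: funext => t; congr integral; apply: funext => s.
by rewrite /cut_square /= mulrAC.
Qed.

Lemma int1_int1_eq0_ae (h : R * R -> R) : measurable_fun setT h ->
  (exists M, forall p, `|h p| <= M) -> (forall p, 0 <= h p) ->
  int1 (fun s => int1 (fun t => h (s, t))) = 0 ->
  {ae (mu \x mu)%E, forall z, z \in @unit_sq R -> h z = 0}.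
Proof.
move=> mh bh h0 H.
have mk := measurable_cut_square mh.
have k0 p := cut_square_ge0 p h0.
have I0 : (\int[(mu \x mu)%E]_z `|cut_square h z| = 0)%E.
  under eq_integral => z _ do rewrite gee0_abs //.
  by rewrite fubini_tonelli1 // /fubini_F -EFin_int1_int1 // H.
have [+ _] := ae_eq_integral_abs (mu \x mu)%E measurableT mk; move=> /(_ I0).
apply: filterS => -[s t] /(_ I); rewrite /cut_square /= => -[].
rewrite inE /unit_sq /= => E [Is It]; move: E.
have inI (u : R) : u \in `[0%R, 1%R] -> (u \in I01) = true by move=> H'; exact: mem_set.
by rewrite (inI s Is) (inI t It) !mulr1.
Qed.

(** An arbitrary list of variables, outermost first, lets the two sides of a bipartite pattern be
    integrated as separate blocks and reordered. *)
Fixpoint iints (l : seq nat) (F : (nat -> R) -> R) (x : nat -> R) : R :=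
  if l is v :: l' then int1 (fun s => iints l' F (upd x v s)) else F x.

Lemma iint_iints n F x : iint n F x = iints (rev (iota 0 n)) F x.
Proof.
elim: n x => [|n IH] x //=; rewrite -[in RHS]/(iota 0 n.+1) -addn1 iotaD rev_cat /= add0n.
by congr Rintegral; apply: funext => s; rewrite IH.
Qed.

Lemma iints_cat l1 l2 F x : iints (l1 ++ l2) F x = iints l1 (iints l2 F) x.
Proof. by elim: l1 x => //= v l1 IH x; congr int1; apply: funext => s; apply: IH. Qed.

Lemma eq_iints l F G x :
  (forall y, (forall i, i \in l -> 0 <= y i <= 1) -> (forall i, i \notin l -> y i = x i) ->
    F y = G y) ->
  iints l F x = iints l G x.
Proof.
elim: l x => [|v l IH] x E /=; first by apply: E.
apply: eq_int1 => s s01; apply: IH => y y1 y2; apply: E => i.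
  rewrite inE => /orP[/eqP->|/y1//].
  by case: (boolP (v \in l)) => [/y1//|/y2->]; rewrite /upd eqxx.
by rewrite inE negb_or => /andP[iv /y2 ->]; rewrite /upd (negbTE iv).
Qed.

Lemma admissible_iints l F : admissible F -> admissible (iints l F).
Proof.
move=> aF; elim: l => [|v l IH] //=; exact: (admissible_int1 v IH).
Qed.

Lemma iints_ge0 l F x : (forall y, 0 <= F y) -> 0 <= iints l F x.
Proof. by move=> F0; elim: l x => [|v l IH] x //=; apply: int1_ge0. Qed.

Lemma iints_le l F G x : admissible F -> admissible G -> (forall y, F y <= G y) ->
  iints l F x <= iints l G x.
Proof.
move=> aF aG le; elim: l x => [|v l IH] x //=.
by apply: int1_le => //; apply: admissible_upd; apply: admissible_iints.
Qed.

Lemma iintsD l F G x : admissible F -> admissible G ->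
  iints l (fun y => F y + G y) x = iints l F x + iints l G x.
Proof.
move=> aF aG; elim: l x => [|v l IH] x //=.
rewrite -int1D; try by apply: admissible_upd; apply: admissible_iints.
by congr int1; apply: funext => s.
Qed.

Lemma iintsZ l c F x : admissible F -> iints l (fun y => c * F y) x = c * iints l F x.
Proof.
move=> aF; elim: l x => [|v l IH] x //=.
rewrite -int1Z; last by apply: admissible_upd; apply: admissible_iints.
by congr int1; apply: funext => s.
Qed.

Lemma iints_cst l c x : iints l (fun=> c) x = c.
Proof.
elim: l x => //= v l IH x; rewrite -[RHS](int1_cst c); congr int1; by apply: funext => s.
Qed.

Lemma iints_sum (I : finType) l (c : I -> R) (F : I -> (nat -> R) -> R) x :
  (forall i, admissible (F i)) ->
  iints l (fun y => \sum_i c i * F i y) x = \sum_i c i * iints l (F i) x.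
Proof.
move=> aF.
have acF i : admissible (fun y => c i * F i y) by apply: admissibleM => //; exact: admissible_cst.
elim: (index_enum I) => [|i r IH].
  by rewrite big_nil; under [X in iints l X]eq_fun do rewrite big_nil; exact: iints_cst.
rewrite big_cons -IH -iintsZ // -iintsD //; last exact: admissible_sum.
by congr iints; apply: funext => y; rewrite big_cons.
Qed.

(** A qualitative substitute for Hölder's inequality: the vanishing of the integral of a power
    passes to its base, almost everywhere at each layer. *)
Lemma iints_eq0_imp l F G x : admissible F -> admissible G ->
  (forall y, 0 <= F y) -> (forall y, 0 <= G y) -> (forall y, F y = 0 -> G y = 0) ->
  iints l F x = 0 -> iints l G x = 0.
Proof.
move=> aF aG F0 G0 FG; elim: l x => [|v l IH] x /=; first exact: FG.
move=> H; have bF : bmeas (fun s => iints l F (upd x v s)).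
  by apply: admissible_upd; apply: admissible_iints.
apply: ae_int1_eq0; first by apply: admissible_upd; apply: admissible_iints.
have bF0 s : 0 <= iints l F (upd x v s) by apply: iints_ge0.
have := int1_eq0 bF bF0 H.
by apply: ae_imply => s H' Is; apply: IH; apply: H'.
Qed.

Lemma iints_prod l (g : R -> R) x : bmeas g -> uniq l ->
  iints l (fun y => \prod_(v <- l) g (y v)) x = int1 g ^+ size l.
Proof.
move=> bg; have ag v : admissible (fun y => g (y v)).
  case: bg => mg [M bM]; split; first by exists M.
  by move=> d T h mh; exact: (measurableT_comp mg (mh v)).
elim: l x => [|v l IH] x /=; first by rewrite big_nil.
move=> /andP[vl ul].
transitivity (int1 (fun s => int1 g ^+ size l * g s)); last by rewrite int1Z // exprSr.
congr int1; apply: funext => s.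
rewrite mulrC -(IH (upd x v s) ul) -iintsZ; last exact: admissible_prod.
apply: eq_iints => y _ /(_ v vl); rewrite big_cons => ->.
by rewrite /upd eqxx.
Qed.

(** The innermost variable is brought outermost by successive Tonelli exchanges. *)
Lemma iints_rcons l u F x : admissible F -> (forall y, 0 <= F y) -> u \notin l ->
  iints (rcons l u) F x = iints (u :: l) F x.
Proof.
move=> aF F0; elim: l x => [|v l IH] x //=; rewrite inE negb_or => /andP[uv ul].
transitivity (int1 (fun s => int1 (fun t => iints l F (upd (upd x v s) u t)))).
  by congr int1; apply: funext => s; rewrite IH.
have ai := admissible_iints l aF.
rewrite (@int1_swap (fun p => iints l F (upd (upd x v p.1) u p.2))).
- congr int1; apply: funext => t; congr int1; apply: funext => s; congr iints.
  apply: funext => i; rewrite /upd; case: eqP => [->|//]; by rewrite (negbTE uv).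
- case: ai => _ H; apply: H => i; rewrite /upd; case: eqP => _; first exact: measurable_snd.
  by case: eqP => _; [exact: measurable_fst | exact: measurable_cst].
- by case: ai => [[M bM] _]; exists M.
- by move=> p; apply: iints_ge0.
Qed.

Lemma rev_iotaD a k m : rev (iota a (k + m)) = rev (iota (a + k) m) ++ rev (iota a k).
Proof. by rewrite iotaD rev_cat. Qed.

Lemma prod_rev_iota (k a : nat) (G : nat -> R) :
  \prod_(v <- rev (iota a k)) G v = \prod_(i < k) G (a + i)%N.
Proof.
rewrite (perm_big (iota a k)) ?perm_rev //= -[a in iota a]addn0 iotaDl big_map.
by rewrite -[k in LHS]subn0 -/(index_iota 0 k) big_mkord.
Qed.

(** With the right variables fixed, the left ones integrate to a power of [h], the integral over a
    single left variable; so the integral of [h] vanishes as well. With variable 0 moved outermost,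
    the right variables integrate to the [m]-th power of the integral of [f (s, t)] over [t], which
    is therefore 0 for almost every [s]. *)
Lemma complete_bipartite_integral_eq0 (f : R * R -> R) k m x :
  measurable_fun setT f -> (exists M, forall p, `|f p| <= M) -> (forall p, 0 <= f p) ->
  iint (k.+1 + m) (fun y => \prod_(p : 'I_k.+1 * 'I_m) f (y p.1, y (k.+1 + p.2)%N)) x = 0 ->
  int1 (fun s => int1 (fun t => f (s, t))) = 0.
Proof.
move=> mf [M bM] f0; rewrite iint_iints rev_iotaD iints_cat add0n => H.
have af i j : admissible (fun y => f (y i, y j)).
  split; first by exists M.
  by move=> d T g mg; apply: (measurableT_comp mf); apply: measurable_fun_pair.
have bf s : bmeas (fun t => f (s, t)) by split; [exact: measurable_fun_pair2 | exists M].
pose G y := \prod_(j < m) f (y 0%N, y (k.+1 + j)%N).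
have aG : admissible G by apply: admissible_prod.
have G0 y : 0 <= G y by apply: prodr_ge0.
pose h := iints [:: 0%N] G.
have ah : admissible h by apply: admissible_iints.
have h0 y : 0 <= h y by apply: iints_ge0.
have ahk : admissible (fun y => h y ^+ k.+1).
  have := @admissible_prod 'I_k.+1 (index_enum _) xpredT (fun _ => h) (fun _ => ah).
  by under eq_fun do rewrite prodr_const card_ord.
have E y : iints (rev (iota 0 k.+1))
    (fun y => \prod_(p : 'I_k.+1 * 'I_m) f (y p.1, y (k.+1 + p.2)%N)) y = h y ^+ k.+1.
  pose g s := \prod_(j < m) f (s, y (k.+1 + j)%N).
  have bg : bmeas g.
    have : admissible (fun z : nat -> R => \prod_(j < m) f (z 0%N, y (k.+1 + j)%N)).
      apply: admissible_prod => j; split; first by exists M.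
      by move=> d T g' mg; apply: (measurableT_comp mf); apply: measurable_fun_pair; [|exact: measurable_cst].
    by move=> /(admissible_upd y 0); congr bmeas; apply: funext => s; rewrite /upd.
  have -> : h y = int1 g.
    by rewrite /h /=; congr int1; apply: funext => s; rewrite /G /g /upd /= eqxx.
  rewrite -[k.+1 in RHS](size_iota 0) -size_rev -(iints_prod y bg) ?rev_uniq ?iota_uniq //.
  apply: eq_iints => z _ zy; rewrite prod_rev_iota.
  rewrite -(pair_bigA _ (fun (i : 'I_k.+1) (j : 'I_m) => f (z i, z (k.+1 + j)%N))) /=.
  apply: eq_bigr => i _; rewrite add0n; apply: eq_bigr => j _; rewrite (zy (k.+1 + j)%N) //.
  by rewrite mem_rev mem_iota add0n -leqNgt leq_addr.
have {}H : iints (rev (iota k.+1 m)) (fun y => h y ^+ k.+1) x = 0.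
  by rewrite -H; congr iints; apply: funext => y; rewrite E.
have : iints (rev (iota k.+1 m)) h x = 0.
  apply: iints_eq0_imp H => //; first by move=> y; apply: exprn_ge0.
  by move=> y /eqP; rewrite expf_eq0 => /andP[_ /eqP].
rewrite -iints_cat cats1 iints_rcons //; last by rewrite mem_rev mem_iota.
have {}E y : iints (rev (iota k.+1 m)) G y = int1 (fun t => f (y 0%N, t)) ^+ m.
  rewrite -[m in RHS](size_iota k.+1) -size_rev -(iints_prod y (bf _)) ?rev_uniq ?iota_uniq //.
  apply: eq_iints => z _ zy; rewrite prod_rev_iota; apply: eq_bigr => j _; rewrite (zy 0%N) //.
  by rewrite mem_rev mem_iota.
rewrite /= => {}H.
have bi : bmeas (fun s => int1 (fun t => f (s, t))).
  by split; [apply: measurable_int1 => //; exists M | exists M => s; apply: norm_int1].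
apply: ae_int1_eq0 => //.
have bI : bmeas (fun s => iints (rev (iota k.+1 m)) G (upd x 0 s)).
  by apply: admissible_upd; apply: admissible_iints.
have I0 s : 0 <= iints (rev (iota k.+1 m)) G (upd x 0 s) by apply: iints_ge0.
have := int1_eq0 bI I0 H; apply: ae_imply => s Hs Is; have := Hs Is.
by rewrite E /upd eqxx => /eqP; rewrite expf_eq0 => /andP[_ /eqP].
Qed.

End UnitIntegral.

(** * Limits of graphs omitting a bipartite pattern *)

Lemma hom_countE (F : graph) (V : finType) (e : rel V) :
  hom_count F e = #|[pred f : {ffun gV F -> V} | [forall u, forall v, gE u v ==> e (f u) (f v)]]|.
Proof.
by apply: eq_card => f; apply/idP/idP => [/set_mem|H]; [|apply/mem_set].
Qed.

Section BipartitePatterns.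
Variables (k m : nat).

Definition bip_dir (S : {set 'I_k * 'I_m}) (u v : 'I_(k + m)) : bool :=
  match fintype.split u, fintype.split v with inl i, inr j => (i, j) \in S | _, _ => false end.

Definition bip_adj S : rel 'I_(k + m) := fun u v => bip_dir S u v || bip_dir S v u.

Lemma bip_adj_sym S : symmetric (bip_adj S).
Proof. by move=> u v; rewrite /bip_adj orbC. Qed.

Lemma bip_adj_irr S : irreflexive (bip_adj S).
Proof. by move=> u; rewrite /bip_adj orbb /bip_dir; case: (fintype.split u). Qed.

Definition bip_graph S : graph := Graph (bip_adj_sym S) (bip_adj_irr S).

Lemma bip_dir_shift S i j : bip_dir S (lshift m i) (rshift k j) = ((i, j) \in S).
Proof. by rewrite /bip_dir (unsplitK (inl i)) (unsplitK (inr j)). Qed.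

Lemma bip_dirP (S : {set 'I_k * 'I_m}) u v :
  reflect (exists2 q, q \in S & u = lshift m q.1 /\ v = rshift k q.2) (bip_dir S u v).
Proof.
apply: (iffP idP) => [|[[i j] qS [-> ->]]]; last by rewrite bip_dir_shift.
rewrite /bip_dir; case: (split_ordP u) => i -> //; case: (split_ordP v) => j -> // ijS.
by exists (i, j).
Qed.

Variable R : realType.

Lemma natr_all_prod (I : finType) (A : {set I}) (b : I -> bool) :
  [forall q in A, b q]%:R = \prod_(q in A) (b q)%:R :> R.
Proof.
case: (boolP [forall q in A, b q]) => [/forall_inP H|].
  by rewrite big1 // => q /H ->.
by rewrite negb_forall_in => /exists_inP[q qA /negbTE nb]; rewrite (bigD1 q) //= nb mul0r.
Qed.

Lemma hom_count_bip S (V : finType) (e : rel V) : symmetric e ->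
  (hom_count (bip_graph S) e)%:R =
  \sum_(f : {ffun 'I_(k + m) -> V})
    \prod_(q in S) (e (f (lshift m q.1)) (f (rshift k q.2)))%:R :> R.
Proof.
move=> es; rewrite hom_countE -sum1_card natr_sum big_mkcond /=.
apply: eq_bigr => f _; rewrite -natr_all_prod inE.
have -> : [forall u, forall v, bip_adj S u v ==> e (f u) (f v)] =
    [forall q in S, e (f (lshift m q.1)) (f (rshift k q.2))].
  apply/forallP/forall_inP => [H q qS|H u].
    have /forallP/(_ (rshift k q.2))/implyP := H (lshift m q.1); apply.
    by rewrite /bip_adj bip_dir_shift -surjective_pairing qS.
  apply/forallP => v; apply/implyP => /orP[/bip_dirP|/bip_dirP] [q qS [-> ->]]; first exact: H.
  by rewrite es; apply: H.
by case: [forall q in _, _].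
Qed.

Lemma graphon_density_bip S (W : R -> R -> R) :
  graphon_density (bip_graph S) W =
  iint (k + m) (fun x => \prod_(q in S) W (x q.1) (x (k + q.2)%N)) (fun=> 0).
Proof.
rewrite /graphon_density /= [X in iint X]card_ord; congr iint; apply: funext => x.
pose h (q : 'I_k * 'I_m) := (lshift m q.1, rshift k q.2).
have hI : injective h.
  by move=> [i j] [i' j'] /eqP; rewrite xpair_eqE => /andP[/eqP/lshift_inj /= -> /eqP/rshift_inj /= ->].
rewrite (eq_bigl (fun p => p \in [set h q | q in S]%SET)); last first.
  move=> [u v] /=; rewrite !enum_rank_ord /=.
  apply/andP/imsetP => [[lt /orP[/bip_dirP|/bip_dirP] [q qS [eu ev]]]|[q qS [-> ->]]].
  - by exists q => //; rewrite eu ev.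
  - by move: lt; rewrite eu ev /= ltnNge (leq_trans (ltnW (ltn_ord _)) (leq_addr _ _)).
  - by rewrite /bip_adj bip_dir_shift -surjective_pairing qS /=; split=> //; apply: ltn_addr.
rewrite big_imset /=; last by move=> q q' _ _ /hI.
by apply: eq_bigr => q _; rewrite !enum_rank_ord.
Qed.

End BipartitePatterns.

Section PatternExpansion.
Variables (R : realType) (Q : finType) (U : pred Q).

Definition pattern (w : Q -> R) : R := \prod_q (if U q then w q else 1 - w q).

(** Inclusion-exclusion sign: 0 unless [S] contains [U], and then -1 to the number of elements of
    [S] outside [U]. *)
Definition pattern_coef (S : {set Q}) : R :=
  \prod_q (if q \in S then (if U q then 1 else -1) else (if U q then 0 else 1)).

Lemma patternE w : pattern w = \sum_S pattern_coef S * \prod_(q in S) w q.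
Proof.
rewrite /pattern; under eq_bigr => q _.
  rewrite (_ : (if U q then _ else _) = (if U q then 1 else -1) * w q + (if U q then 0 else 1)).
    over.
  by case: (U q); ring.
rewrite bigA_distr; apply: eq_bigr => S _.
rewrite /pattern_coef [X in _ * X]big_mkcond -big_split /=; apply: eq_bigr => q _.
by case: (q \in S); rewrite ?mulr1.
Qed.

Lemma pattern_natr (b : Q -> bool) : pattern (fun q => (b q)%:R) != 0 -> forall q, b q = U q.
Proof.
move=> nz q; move: nz; rewrite /pattern (bigD1 q) //= mulf_eq0 negb_or => /andP[+ _].
by case: (U q); case: (b q); rewrite ?subrr ?eqxx.
Qed.
End PatternExpansion.

Section RandomFree.
Variable R : realType.

Lemma random_free_of_not_shattered (Hs : nat -> {V : finType & rel V}) (W : R -> R -> R) (N : nat) :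
  (forall n, symmetric (projT2 (Hs n))) ->
  (forall n (a : 'I_N -> projT1 (Hs n)) (b : {set 'I_N} -> projT1 (Hs n)),
    ~ forall i J, projT2 (Hs n) (a i) (b J) = (i \in J)) ->
  graphon W -> L_converges Hs W -> random_free_graphon W.
Proof.
move=> es nsh [mW W01] cv.
(* One right vertex for each subset of the left side. The extra left vertex only makes the left side
   nonempty; shattering is tested on the first [N]. *)
pose k := N.+1; pose m := #|{set 'I_k}|.
pose Q : finType := ('I_k * 'I_m)%type.
pose U (q : Q) := q.1 \in (enum_val q.2 : {set 'I_k}).
pose c := @pattern_coef R Q U.
have zero n : \sum_S c S * hom_density R (bip_graph S) (Hs n) = 0.
  have -> : \sum_S c S * hom_density R (bip_graph S) (Hs n) =
      (\sum_S c S * (hom_count (bip_graph S) (projT2 (Hs n)))%:R) / (#|projT1 (Hs n)|%:R ^+ (k + m)).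
    rewrite mulr_suml; apply: eq_bigr => S _; rewrite mulrA /hom_density /=.
    by rewrite card_ord.
  under eq_bigr => S _ do rewrite hom_count_bip // mulr_sumr.
  rewrite exchange_big /= big1 ?mul0r // => f _; rewrite -patternE.
  (* A map of nonzero weight realises the pattern exactly, which is a shattering; it may fail to be
     injective, but shattering is excluded for arbitrary [a] and [b]. *)
  apply/eqP/negPn/negP => /pattern_natr H.
  pose wd := widen_ord (leqnSn N) : 'I_N -> 'I_k.
  apply: (nsh n (fun i => f (lshift m (wd i)))
                (fun J => f (rshift k (enum_rank [set wd i | i in J]%SET)))) => i J.
  have -> := H (wd i, enum_rank [set wd i | i in J]%SET); rewrite /U /= enum_rankK mem_imset //.
  by move=> x y /(congr1 val) /= /val_inj.
(* A graphon is controlled on the unit square only; extension by 0 makes it bounded and measurable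
   on the whole plane. *)
pose W0 : R * R -> R := (fun z => W z.1 z.2) \_ (@unit_sq R).
have mU : measurable (@unit_sq R) by apply: measurableX; exact: measurable_itv.
have mW0 : measurable_fun setT W0.
  by have [+ _] := measurable_restrictT (fun z : R * R => W z.1 z.2) mU; apply.
have W0E s t : 0 <= s <= 1 -> 0 <= t <= 1 -> W0 (s, t) = W s t.
  move=> hs ht; rewrite /W0 patchE ifT //; apply/mem_set; split; by rewrite /= in_itv.
have W0b z : 0 <= W0 z <= 1.
  rewrite /W0 patchE; case: ifP => [/set_mem[H1 H2]|_]; last by rewrite lexx ler01.
  by have [] := W01 z.1 z.2 H1 H2.
have aW i j : admissible (fun x : nat -> R => W0 (x i, x j)).
  split; first by exists 1 => x; have /andP[? ?] := W0b (x i, x j); rewrite ger0_norm.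
  by move=> d T g mg; apply: (measurableT_comp mW0); apply: measurable_fun_pair.
have gd (S : {set Q}) : graphon_density (bip_graph S) W =
    iints (rev (iota 0 (k + m))) (fun x => \prod_(q in S) W0 (x q.1, x (k + q.2)%N)) (fun=> 0).
  rewrite graphon_density_bip iint_iints; apply: eq_iints => y y1 _.
  apply: eq_bigr => q _; rewrite W0E //; apply: y1; rewrite mem_rev mem_iota /= add0n.
    by apply: ltn_addr.
  by rewrite ltn_add2l.
have lim0 : \sum_S c S * graphon_density (bip_graph S) W = 0.
  have : (fun n => \sum_S c S * hom_density R (bip_graph S) (Hs n)) @ \oo -->
      \sum_S c S * graphon_density (bip_graph S) W.
    elim: (index_enum _) => [|S r IH].
      by under eq_fun do rewrite big_nil; rewrite big_nil; exact: cvg_cst.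
    under eq_fun do rewrite big_cons; rewrite big_cons.
    by apply: cvgD => //; apply: cvgMr; exact: cv.
  under eq_fun do rewrite zero.
  by move=> /cvg_lim <- //; rewrite lim_cst.
have pat0 : iints (rev (iota 0 (k + m)))
    (fun x => pattern U (fun q => W0 (x q.1, x (k + q.2)%N))) (fun=> 0) = 0.
  rewrite -[RHS]lim0; under eq_bigr => S _ do rewrite gd.
  rewrite -iints_sum; last by move=> S; apply: admissible_prod => q; apply: aW.
  by congr iints; apply: funext => x; rewrite patternE.
(* Below both [W0] and [1 - W0], hence below whichever factor the pattern uses at a pair. *)
pose f z := W0 z * (1 - W0 z).
have af i j : admissible (fun x : nat -> R => f (x i, x j)).
  apply: admissibleM => //; apply: admissibleD; first exact: admissible_cst.
  have -> : (fun x : nat -> R => - W0 (x i, x j)) = (fun x => -1 * W0 (x i, x j)).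
    by apply: funext => x; rewrite mulN1r.
  by apply: admissibleM => //; exact: admissible_cst.
have f0 z : 0 <= f z by have /andP[? ?] := W0b z; rewrite mulr_ge0 // subr_ge0.
have mf : measurable_fun setT f.
  by apply: measurable_funM => //; apply: measurable_funB => //; exact: measurable_cst.
have bf : exists M, forall z, `|f z| <= M.
  by exists 1 => z; rewrite ger0_norm //; have /andP[? ?] := W0b z; rewrite mulr_ile1 //; lra.
have f_int : int1 (fun s => int1 (fun t => f (s, t))) = 0.
  apply: (@complete_bipartite_integral_eq0 R f N m (fun=> 0)) => //.
  rewrite iint_iints; apply/eqP; rewrite eq_le; apply/andP; split; last first.
    by apply: iints_ge0 => y; apply: prodr_ge0.
  rewrite -[X in _ <= X]pat0; apply: iints_le.
  - by apply: admissible_prod => q; apply: af.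
  - have -> : (fun x : nat -> R => pattern U (fun q : Q => W0 (x q.1, x (k + q.2)%N))) =
       (fun x => \sum_S c S * \prod_(q in S) W0 (x q.1, x (k + q.2)%N)).
      by apply: funext => x; rewrite patternE.
    apply: admissible_sum => S; apply: admissibleM; first exact: admissible_cst.
    by apply: admissible_prod => q; apply: aW.
  move=> y; apply: ler_prod => q _; rewrite f0 /=.
  have /andP[? ?] := W0b (y q.1, y (k + q.2)%N); rewrite /f.
  by case: (U q); [rewrite ler_piMr // | rewrite ler_piMl //]; lra.
apply: (@filterS _ _ (ae_filter_ringOfSetsType _) _ _ _ (int1_int1_eq0_ae mf bf f0 f_int)).
move=> z H zu; have /eqP := H zu.
have /set_mem [/= z1 z2] := zu.
rewrite /f mulf_eq0 subr_eq0 (surjective_pairing z) W0E; last 2 first.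
- by rewrite in_itv in z1.
- by rewrite in_itv in z2.
by case/orP => /eqP ->; [left | right].
Qed.
End RandomFree.

(** * Random-free interpretations *)

Lemma nowhere_dense_random_free (R : realType) C (S : scheme) : monotone_class C ->
  nowhere_dense C -> valid_scheme S -> random_free_image R C (interp S).
Proof.
move=> HC nd vS Gs CGs W gW cv.
have [N HN] := iedge_not_shattered vS HC nd.
apply: (@random_free_of_not_shattered R (fun n => interp S (Gs n)) W N) => // n.
- exact: iedge_sym.
- exact: (HN (Gs n)).
Qed.

Lemma leq_hom_count (F : graph) (V V' : finType) (e : rel V) (e' : rel V') (g : V -> V') :
  injective g -> (forall x y, e x y -> e' (g x) (g y)) -> (hom_count F e <= hom_count F e')%N.
Proof.
move=> gI ge; rewrite !hom_countE.
pose phi (f : {ffun gV F -> V}) : {ffun gV F -> V'} := [ffun u => g (f u)].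
have phiI : injective phi.
  by move=> f f' /ffunP E; apply/ffunP => u; apply: gI; have := E u; rewrite !ffunE.
rewrite -(fintype.card_image phiI); apply: subset_leq_card; apply/fintype.subsetP => f' /fintype.imageP[f + ->].
rewrite !inE => /forallP H; apply/forallP => u; apply/forallP => v; apply/implyP => uv.
by rewrite !ffunE; apply: ge; have /forallP/(_ v)/implyP := H u; apply.
Qed.

Lemma eq_hom_density (R : realType) (F : graph) (H H' : {V : finType & rel V})
    (g : projT1 H -> projT1 H') :
  bijective g -> (forall x y, projT2 H' (g x) (g y) = projT2 H x y) ->
  hom_density R F H = hom_density R F H'.
Proof.
move=> gB ge; rewrite /hom_density (bij_eq_card gB); congr (_%:R / _).
apply/eqP; rewrite eqn_leq; apply/andP; split.
  by apply: (@leq_hom_count _ _ _ _ _ g (bij_inj gB)) => x y; rewrite ge.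
case: gB => h gh hg; apply: (@leq_hom_count _ _ _ _ _ h (can_inj hg)) => x y.
by rewrite -ge !hg.
Qed.

Section BasicScheme.
Variable th : fo.
Hypothesis vth : valid_basic th.

(** Classes of equality are singletons, and [FEq 0 0] is a tautology that keeps every vertex. *)
Definition basic_scheme : scheme := Scheme 0 (FEq 0 1) (FEq 0 0) th.

Lemma env2_pair (G : graph) (t u : 1.-tuple (gV G)) :
  holds (@gE G) (@env2 _ 0 t u) th = holds (@gE G) (env_pair (tnth t ord0) (tnth u ord0)) th.
Proof.
have [fvth _] := vth; apply: holds_agree fvth _ => -[|[|i]] // _; rewrite /env2 /env_pair.
  by rewrite nth_cat size_tuple /= -(tnth_nth _ t ord0).
by rewrite nth_cat size_tuple /= -(tnth_nth _ u ord0).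
Qed.

Lemma env2_eq (G : graph) (t u : 1.-tuple (gV G)) :
  holds (@gE G) (@env2 _ 0 t u) (FEq 0 1) = (t == u).
Proof.
have -> : (t == u) = (tnth t ord0 == tnth u ord0).
  by apply/eqP/eqP => [->//|E]; apply: eq_from_tnth => i; rewrite !ord1.
by rewrite /= /env2 !nth_cat !size_tuple /= -(tnth_nth _ t ord0) -(tnth_nth _ u ord0).
Qed.

Lemma basic_scheme_valid : valid_scheme basic_scheme.
Proof.
have [fvth vth2] := vth; split=> // G; split; last split.
- split=> [t|]; first by rewrite env2_eq.
  by split=> [t u|t u w]; rewrite !env2_eq => /eqP -> //.
- split=> [t u|t t' u u']; first by rewrite /= !eqxx.
  by rewrite !env2_eq => /eqP -> /eqP ->.
- split=> [t u _ _|t _]; rewrite !env2_pair.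
    by case: (vth2 G (tnth t ord0) (tnth u ord0)).
  by case: (vth2 G (tnth t ord0) (tnth t ord0)).
Qed.

Lemma basic_hom_density (R : realType) F G :
  hom_density R F (basic_interp th G) = hom_density R F (interp basic_scheme G).
Proof.
have vS (v : gV G) : @iclass basic_scheme G [tuple v] \in ivset basic_scheme G.
  by apply/imsetP; exists [tuple v] => //; apply/mem_set; rewrite /= eqxx.
have iclassE t : @iclass basic_scheme G t = [set t]%SET.
  by apply/setP => u; rewrite !inE env2_eq eq_sym.
pose g (v : gV G) : ivert basic_scheme G :=
  exist (fun A => A \in ivset basic_scheme G) (@iclass basic_scheme G [tuple v]) (vS v).
have gI : injective g.
  by move=> u v /(congr1 val) /=; rewrite !iclassE => /set1_inj /(congr1 (fun t => tnth t ord0)).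
apply: (@eq_hom_density R F (basic_interp th G) (interp basic_scheme G) g).
  apply: inj_card_bij gI _; rewrite card_sig.
  apply: leq_trans (leq_imset_card _ _) _; apply: leq_trans (max_card _) _.
  by rewrite card_tuple expn1.
by move=> u v; rewrite /= (@iedge_rep _ basic_scheme_valid G (g u) (g v) [tuple u] [tuple v]).
Qed.
End BasicScheme.

Lemma random_free_schemes_basic (R : realType) C :
  (forall S : scheme, valid_scheme S -> random_free_image R C (interp S)) ->
  forall th : fo, valid_basic th -> random_free_image R C (basic_interp th).
Proof.
move=> H th vth Gs CGs W gW cv.
apply: (H _ (basic_scheme_valid vth) Gs CGs W gW) => F.
by under eq_fun do rewrite -basic_hom_density //; exact: cv.
Qed.

(** * Convergence to the constant graphon *)

Lemma bernoulli_ge (R : realFieldType) (eps : R) n : 0 <= eps <= 1 ->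
  1 - n%:R * eps <= (1 - eps) ^+ n.
Proof.
move=> /andP[e0 e1]; elim: n => [|n IH]; first by rewrite mul0r subr0 expr0.
rewrite exprS; apply: le_trans (_ : (1 - eps) * (1 - n%:R * eps) <= _); last first.
  by rewrite ler_wpM2l // subr_ge0.
rewrite -natr1; have : 0 <= n%:R * eps * eps by rewrite !mulr_ge0.
lra.
Qed.

Lemma ffact_ge m n : ((m - n) ^ n <= m ^_ n)%N.
Proof.
rewrite ffact_prod -[X in (_ ^ X <= _)%N](card_ord n) -prod_nat_const.
by apply: leq_prod => i _; rewrite leq_sub2l // ltnW.
Qed.

(** Here [t] counts all maps, [g] the injective leaf maps, [a] the compatible ones among these, and
    [h] the homomorphisms. With [y] = [g / t], both [h / t] and [c^-1] lie between [y / c] and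
    [y / c + (1 - y)]. *)
Lemma near_reciprocal (R : realFieldType) (a h g t c B : R) : 0 < t -> a <= h -> h + g <= a + t ->
  a * c = g -> 1 <= c -> 1 - B <= g / t -> `|h / t - c^-1| <= B.
Proof.
move=> t0 ah hg ac c1 gB; have c0 : 0 < c by apply: lt_le_trans c1.
pose y := g / t; rewrite -/y in gB.
have aE : a / t = y / c by rewrite /y -ac mulrAC mulfK // gt_eqF.
have x1 : y / c <= h / t by rewrite -aE ler_pM2r // invr_gt0.
have x2 : h / t <= y / c + (1 - y).
  have : (h + g) / t <= (a + t) / t by rewrite ler_pM2r // invr_gt0.
  by rewrite !mulrDl aE divff ?gt_eqF // -/y; lra.
have y1 : y <= 1 by have := le_trans x1 x2; rewrite lerDl subr_ge0.
have ci : c^-1 <= 1 by rewrite invf_le1.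
have ci0 : 0 < c^-1 by rewrite invr_gt0.
have l1 : (1 - y) * c^-1 <= 1 - y by rewrite ler_piMr // subr_ge0.
have l0 : 0 <= (1 - y) * c^-1 by rewrite mulr_ge0 ?subr_ge0 // ltW.
rewrite mulrBl mul1r in l0 l1; rewrite ler_norml; apply/andP; split; lra.
Qed.

Section LeafyLimit.
Variables (R : realType) (p : nat).

(** With the square of the number of sites as leaves per site, the leaves grow cubically, against at
    most quadratically many other vertices. *)
Definition leafy_seq (d : nat) : graph := leafy_graph d.+1 p (#|site d.+1| ^ 2).

(** Per vertex of [F] the loss is at most [(n + p.+1) / D]: the [n] pays for collisions of first
    coordinates, the [p.+1] for vertices that are not leaves. Bernoulli's inequality then bounds the
    [n]-th power. *)
Lemma injective_triples_ratio (F : graph) d :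
  1 - #|gV F|%:R * (#|gV F| + p.+1)%:R / d.+1%:R <=
  #|injective_triples F d.+1 (#|site d.+1| ^ 2)|%:R / #|gV (leafy_seq d)|%:R ^+ #|gV F| :> R.
Proof.
rewrite card_injective_triples; set n := #|gV F|; set T := #|gV _|; set D := d.+1.
have [->|n0] := posnP n; first by rewrite mul0r mul0r subr0 !expn0 expr0 divr1.
(* For small [D] the lower bound is not positive; beyond it the subtractions below are exact. *)
have [lt|le] := ltnP D (n + p.+1).
  apply: le_trans (_ : 0 <= _); last by rewrite divr_ge0 // exprn_ge0.
  rewrite subr_le0 -mulrA -[X in X <= _]mul1r ler_pM ?ler1n //.
  by rewrite ler_pdivlMr ?ltr0n // mul1r ler_nat ltnW.
set K := (2 ^ D)%N; set M := (#|site D| ^ 2)%N.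
have K0 : (0 < K)%N by rewrite expn_gt0.
have siteE : #|site D| = (D * K)%N by rewrite card_prod card_subsets !card_ord.
have /andP[T1 T2] := card_leafy_vertex D p M; rewrite -/T in T1 T2.
have T0 : (0 < T)%N.
  apply: leq_trans T1; rewrite muln_gt0 /M expn_gt0 siteE muln_gt0 K0 //.
(* As the number of sites [D * K] is at most its square [M], the graph has at most
   [M * (D * K + p.+1)] vertices. The rest follows from [D - (n + p.+1) <= D * K]. *)
have key : ((D - (n + p.+1)) * T <= D * ((D - n) * K * M))%N.
  apply: (@leq_trans ((D - (n + p.+1)) * (M * (D * K + p.+1)))).
    rewrite leq_mul2l; apply/orP; right; apply: leq_trans T2 _.
    have h : (#|site D| <= M)%N by rewrite /M siteE -mulnn leq_pmull // muln_gt0 K0.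
    rewrite mulnDr mulnS -/M -siteE (mulnC M) -addnA addnC [X in (_ <= X)%N]addnC.
    rewrite mulnn -/M addnC; lia.
  have -> : (D * ((D - n) * K * M) = M * (D * K * (D - n)))%N by ring.
  have -> : ((D - (n + p.+1)) * (M * (D * K + p.+1)) = M * ((D - (n + p.+1)) * (D * K + p.+1)))%N by ring.
  rewrite leq_mul2l; apply/orP; right.
  have -> : (D - n = (D - (n + p.+1)) + p.+1)%N by lia.
  move: (D - (n + p.+1))%N (leq_subr (n + p.+1) D) => E ED.
  rewrite [X in (X <= _)%N]mulnDr [X in (_ <= X)%N]mulnDr (mulnC E (D * K)%N) leq_add2l leq_mul2r.
  apply/orP; right.
  by apply: leq_trans ED _; rewrite leq_pmulr.
pose eps : R := (n + p.+1)%:R / D%:R.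
have e01 : 0 <= eps <= 1.
  by rewrite divr_ge0 //= ler_pdivrMr ?ltr0n // mul1r ler_nat.
rewrite -mulrA -/eps; apply: le_trans (bernoulli_ge n e01) _.
apply: le_trans (_ : (((D - n) * K * M)%:R / T%:R) ^+ n <= _).
  apply: lerXn2r; rewrite ?nnegrE ?subr_ge0 ?divr_ge0 //; first by case/andP: e01.
  rewrite ler_pdivlMr ?ltr0n // /eps.
  have -> : 1 - (n + p.+1)%:R / D%:R = (D - (n + p.+1))%:R / D%:R :> R.
    by rewrite natrB // mulrBl divff // pnatr_eq0.
  by rewrite mulrAC ler_pdivrMr ?ltr0n // -!natrM ler_nat mulnC (mulnC _ D) mulnC.
rewrite expr_div_n ler_pM2r ?invr_gt0 ?exprn_gt0 ?ltr0n //.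
by rewrite -natrX ler_nat !expnMn !leq_mul2r ffact_ge !orbT.
Qed.

Lemma leafy_hom_density (F : graph) d :
  `|hom_density R F (basic_interp (leaf_fo p) (leafy_seq d)) - (2^-1) ^+ edge_count F| <=
  #|gV F|%:R * (#|gV F| + p.+1)%:R / d.+1%:R.
Proof.
set M := (#|site d.+1| ^ 2)%N; set n := #|gV F|.
have -> : hom_density R F (basic_interp (leaf_fo p) (leafy_seq d)) =
    #|@is_hom F d.+1 p M|%:R / #|leafy_vertex d.+1 p M|%:R ^+ n.
  by rewrite /hom_density hom_countE.
have T0 : (0 < #|leafy_vertex d.+1 p M|)%N.
  have /andP[T1 _] := card_leafy_vertex d.+1 p M; apply: leq_trans T1.
  by rewrite muln_gt0 /M expn_gt0 card_prod card_subsets card_ord muln_gt0 expn_gt0.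
rewrite exprVn -(natrX R 2).
apply: (near_reciprocal (a := #|compatible_triples F d.+1 M|%:R) (g := #|injective_triples F d.+1 M|%:R)).
- by rewrite exprn_gt0 // ltr0n.
- by rewrite ler_nat; exact: compatible_leq_hom.
- by rewrite -natrX -!natrD ler_nat; exact: hom_leq_compatible.
- by rewrite -natrM card_compatible_triples.
- by rewrite ler1n expn_gt0.
- exact: injective_triples_ratio.
Qed.

Lemma graphon_density_half (F : graph) :
  graphon_density F (fun _ _ : R => 2^-1) = (2^-1) ^+ edge_count F.
Proof.
rewrite /graphon_density iint_iints.
under [X in iints _ X]eq_fun do rewrite prodr_const.
rewrite iints_cst /edge_count cardsE; congr (_ ^+ _); apply: eq_card => q.
exact: andbC.
Qed.

Lemma leafy_L_converges :
  L_converges (fun d => basic_interp (leaf_fo p) (leafy_seq d)) (fun _ _ : R => 2^-1).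
Proof.
move=> F; rewrite graphon_density_half.
pose c : R := #|gV F|%:R * (#|gV F| + p.+1)%:R.
have c0 : (fun d => c * harmonic d : R) @ \oo --> (0 : R).
  by rewrite -[X in _ --> X](mulr0 c); apply: cvgMr; exact: cvg_harmonic.
apply: (@squeeze_cvgr _ _ _ _ (fun d => 2^-1 ^+ edge_count F - c * harmonic d)
  (fun d => 2^-1 ^+ edge_count F + c * harmonic d)).
- by near=> d; have := leafy_hom_density F d; rewrite ler_distl.
- by rewrite -[X in _ --> X]subr0; apply: cvgB => //; exact: cvg_cst.
- by rewrite -[X in _ --> X]addr0; apply: cvgD => //; exact: cvg_cst.
Unshelve. all: by end_near. Qed.

End LeafyLimit.

Lemma half_not_random_free (R : realType) : ~ random_free_graphon (fun _ _ : R => 2^-1).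
Proof.
have half : ~ (2^-1 = 0 :> R \/ 2^-1 = 1 :> R) by case=> E; lra.
move=> [A [mA A0 sA]].
have sub : @unit_sq R `<=` A.
  by move=> z zu; apply: sA => H; apply: half (H (mem_set zu)).
have mI : measurable ([set` `[0%R, 1%R]] : set R) by exact: measurable_itv.
have mU : measurable (@unit_sq R) by apply: measurableX.
have : (((@lebesgue_measure R) \x (@lebesgue_measure R)) (@unit_sq R) <= 0)%E.
  by rewrite -A0; apply: le_measure => //; rewrite inE.
rewrite /unit_sq product_measure1E //= !lebesgue_measure_itv /= lte01 oppr0 adde0 mule1.
by rewrite lee_fin; apply/negP; rewrite -ltNge ltr01.
Qed.

Lemma basic_random_free_nowhere_dense (R : realType) C : monotone_class C ->
  (forall th : fo, valid_basic th -> random_free_image R C (basic_interp th)) ->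
  nowhere_dense C.
Proof.
move=> HC H p; apply: contrapT => no.
have sd N : C (subdiv_clique N p) by apply: contrapT => nC; apply: no; exists N.
have Cl d : C (leafy_seq p d).
  by have [N Hf] := leafy_embeds d.+1 p (#|site d.+1| ^ 2); exact (HC (subdiv_clique N p) (leafy_seq p d) (sd N) Hf).
apply: (@half_not_random_free R); apply: (H _ (leaf_fo_valid p) _ Cl).
  split; first exact: measurable_cst.
  by move=> x y _ _; split=> //; lra.
exact: leafy_L_converges.
Qed.

Theorem theorem8p33 (R : realType) (C : graph -> Prop) (HC : monotone_class C) :
  ((forall S : scheme, valid_scheme S -> random_free_image R C (interp S))
     <-> nowhere_dense C) /\
  ((forall th : fo, valid_basic th -> random_free_image R C (basic_interp th))
     <-> nowhere_dense C).
Proof.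
have schemes : nowhere_dense C ->
    forall S : scheme, valid_scheme S -> random_free_image R C (interp S).
  by move=> nd S; apply: nowhere_dense_random_free.
split; split=> //.
- by move/random_free_schemes_basic; apply: basic_random_free_nowhere_dense.
- exact: basic_random_free_nowhere_dense.
- by move/schemes/random_free_schemes_basic.
Qed.
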